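(* Let $X$ be a reflexive Banach space with strictly convex norm and let $Y$ be a closed subspace of $X$. Then: (1) The isometric envelope $\mathrm{Env}(Y)$ is $1$-complemented in $X$. If furthermore $X$ is locally uniformly convex, then: (2) $\mathrm{Env}(Y)$ is the smallest subspace of $X$ containing $Y$ which is the range of a projection belonging to $\overline{\mathrm{conv}(\mathrm{Isom}(X))}^{\mathrm{WOT}}$; and if moreover $X^*$ is strictly convex, then the projection onto $\mathrm{Env}(Y)$ in this set is the minimal projection in $\overline{\mathrm{conv}(\mathrm{Isom}(X))}^{\mathrm{WOT}}$ acting as the identity on $Y$. (3) The Korovkin envelope $\mathrm{Env}_{\mathcal L_1(X)}(Y)$ coincides with the minimal envelope $\mathrm{Env}_{\min}(Y)$.
   Context: $\mathrm{Isom}(X)$ is the group of surjective linear isometries of $X$, and $\mathcal L_1(X)$ is the semigroup of linear contractions (operators of norm at most $1$) on $X$. For a bounded semigroup $S$ of operators on $X$ and $A\subseteq X$, the (Korovkin) envelope $\mathrm{Env}_S(A)$ is the set of $x\in X$ such that whenever a net $(T_i)_{i\in I}$ in $S$ converges pointwise on $A$ to $\mathrm{Id}_A$ (i.e. $T_i a\to a$ in norm for every $a\in A$), then $(T_i x)_{i\in I}$ converges in norm to $x$. The isometric envelope is $\mathrm{Env}(Y):=\mathrm{Env}_{\mathrm{Isom}(X)}(Y)$. A subspace is $1$-complemented if it is the range of a contractive linear projection of $X$. The minimal envelope $\mathrm{Env}_{\min}(Y)$ is the smallest $1$-complemented subspace of $X$ containing $Y$ (it exists when $X$ is reflexive and strictly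 convex). $\overline{\,\cdot\,}^{\mathrm{WOT}}$ denotes closure in the weak operator topology. Projections are ordered by $p\le q$ iff $pq=qp=p$; minimality is with respect to this order. $X$ is locally uniformly convex (LUR) if for every $x_0$ in the unit sphere and $\varepsilon>0$ there is $\delta>0$ such that for all $x$ in the unit ball, $\|\frac{x+x_0}{2}\|>1-\delta$ implies $\|x-x_0\|<\varepsilon$. *)

(* Defs.v *)
From HB Require Import structures.
From mathcomp Require Import all_boot all_order all_algebra.
From mathcomp Require Import complex.
From mathcomp Require Import all_classical all_reals all_analysis.
Set Implicit Arguments.
Unset Strict Implicit.
Unset Printing Implicit Defensive.
Import Order.TTheory GRing.Theory Num.Theory.
Import numFieldNormedType.Exports.
Local Open Scope classical_set_scope.
Local Open Scope ring_scope.

(* The scalars are either the real or the complex numbers.  The library's norm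
   on a [normedModType K] takes its values in [K]; for [K = R[i]] these values
   are nonnegative reals, and [a <= b] in [R[i]] means that [b - a] is a
   nonnegative real. *)
Variant real_or_complex (R : realType) : numFieldType -> Prop :=
| RealScalars : real_or_complex R R
| ComplexScalars : real_or_complex R R[i].

Section Spaces.
Context (K : numFieldType).

Definition strictly_convex_on (V : lmodType K) (D : set V) (N : V -> K) : Prop :=
  forall x y, D x -> D y -> N x = 1 -> N y = 1 -> x <> y ->
    N (2^-1 *: (x + y)) < 1.

Context (X : normedModType K).

Definition subspace_of (Y : set X) : Prop :=
  Y 0 /\ forall (a : K) x y, Y x -> Y y -> Y (a *: x + y).

Definition strictly_convex : Prop :=
  strictly_convex_on setT (fun x : X => `|x|).

Definition locally_uniformly_convex : Prop :=
  forall x0 : X, `|x0| = 1 -> forall e : K, 0 < e ->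
  exists2 d : K, 0 < d &
    forall x : X, `|x| <= 1 -> 1 - d < `|2^-1 *: (x + x0)| -> `|x - x0| < e.

Definition dual_space : set (X -> K^o) :=
  [set phi | linear phi /\ continuous phi].

Definition dual_norm (phi : X -> K^o) : K :=
  supremum 0 [set `|phi x| | x in [set x | `|x| <= 1]].

Definition strictly_convex_dual : Prop := strictly_convex_on dual_space dual_norm.

(* Every bounded linear functional on the dual is an evaluation; the values of
   [Phi] outside [dual_space] are irrelevant. *)
Definition reflexive_space : Prop :=
  forall Phi : (X -> K^o) -> K,
    (forall (a : K) phi psi, dual_space phi -> dual_space psi ->
       Phi (a *: phi + psi) = a * Phi phi + Phi psi) ->
    (exists C : K, forall phi, dual_space phi -> `|Phi phi| <= C * dual_norm phi) ->
    exists x : X, forall phi, dual_space phi -> Phi phi = phi x.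

Definition Isom : set (X -> X) :=
  [set T | [/\ linear T, forall x, `|T x| = `|x| & range T = setT]].

Definition contractions : set (X -> X) :=
  [set T | linear T /\ forall x, `|T x| <= `|x|].

Definition projection (p : X -> X) : Prop := linear p /\ p \o p = p.

Definition proj_le (p q : X -> X) : Prop := p \o q = p /\ q \o p = p.

Definition one_complemented (Z : set X) : Prop :=
  exists p, [/\ contractions p, projection p & range p = Z].

(* Coefficients [0 <= a i] are real also when the scalars are complex. *)
Definition convex_hull (A : set (X -> X)) : set (X -> X) :=
  [set T | exists (n : nat) (a : 'I_n -> K) (S : 'I_n -> X -> X),
     [/\ forall i, 0 <= a i, \sum_i a i = 1, forall i, A (S i) &
         T = fun x => \sum_i a i *: S i x]].

(* Closure, in the space of bounded linear operators, for the topology with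
   basic neighbourhoods {S | |phi_k (S x_k) - phi_k (T x_k)| < e, k < n}. *)
Definition wot_closure (A : set (X -> X)) : set (X -> X) :=
  [set T | [/\ linear T, continuous T &
     forall (n : nat) (x : 'I_n -> X) (phi : 'I_n -> X -> K^o) (e : K),
       (forall k, dual_space (phi k)) -> 0 < e ->
       exists2 S, A S & forall k, `|phi k (S (x k)) - phi k (T (x k))| < e]].

End Spaces.

Arguments strictly_convex {K} X.
Arguments locally_uniformly_convex {K} X.
Arguments strictly_convex_dual {K} X.
Arguments reflexive_space {K} X.
Arguments Isom {K} X.
Arguments contractions {K} X.
Arguments dual_space {K} X.

Definition wot_convex_isom (K : numFieldType) (X : normedModType K) :
    set (X -> X) :=
  wot_closure (convex_hull (Isom X)).
Arguments wot_convex_isom {K} X.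

Definition directed_preorder (I : Type) (le : I -> I -> Prop) : Prop :=
  [/\ inhabited I, forall i, le i i,
      forall i j k, le i j -> le j k -> le i k &
      forall i j, exists k, le i k /\ le j k].

Definition tails (I : Type) (le : I -> I -> Prop) : set_system I :=
  [set A | exists i, forall j, le i j -> A j].

Definition korovkin_envelope (K : numFieldType) (X : normedModType K)
    (S : set (X -> X)) (A : set X) : set X :=
  [set x | forall (I : Type) (le : I -> I -> Prop) (T : I -> X -> X),
     directed_preorder le -> (forall i, S (T i)) ->
     (forall a, A a -> T i a @[i --> tails le] --> a) ->
     T i x @[i --> tails le] --> x].

Definition isometric_envelope (K : numFieldType) (X : normedModType K)
    (Y : set X) : set X :=
  korovkin_envelope (Isom X) Y.

Definition smallest_containing (T : Type) (C : set (set T)) (Y Z : set T) : Prop :=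
  [/\ C Z, Y `<=` Z & forall W, C W -> Y `<=` W -> Z `<=` W].

Definition is_minimal_envelope (K : numFieldType) (X : normedModType K)
    (Y Z : set X) : Prop :=
  smallest_containing (@one_complemented K X) Y Z.

(* Least, hence by antisymmetry of [proj_le] the unique minimal, projection. *)
Definition is_minimal_projection (K : numFieldType) (X : normedModType K)
    (P : set (X -> X)) (p : X -> X) : Prop :=
  P p /\ forall q, P q -> proj_le p q.

(* Main.v *)
Require Import Defs.
From HB Require Import structures.
From mathcomp Require Import all_boot all_order all_algebra.
From mathcomp Require Import complex.
From mathcomp Require Import all_classical all_reals all_analysis.
From mathcomp Require Import ring lra.
Import Order.TTheory GRing.Theory Num.Theory.
Import numFieldNormedType.Exports.
Local Open Scope classical_set_scope.
Local Open Scope ring_scope.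
Set Implicit Arguments.
Unset Strict Implicit.
Unset Printing Implicit Defensive.

(** The statement is about fixed spaces of semigroups of contractions, and its
    analytic core is compactness along ultrafilters.

    On a reflexive space a family of contractions has, along any ultrafilter, a
    limit in the weak operator topology ([ultra_wot_cvg]).  Call a set [C] of
    contractions a convex semigroup if it contains the identity and is stable
    under composition, convex combinations and such limits.  If moreover the
    norm is strictly convex, the common fixed space of [C] is the range of a
    projection that belongs to [C] ([fixed_space_projection]).  Indeed Cesaro
    means give for every [T] in [C] some [p] in [C] with [T \o p = p]; strict
    convexity shows that the fixed points of [(S + T) / 2] are the common fixed
    points of [S] and [T], so these [p] are directed, and a limit of them
    projects onto the space fixed by all of [C].

    It remains to write each envelope as such a fixed space.  Let [L] be the set
    of weak operator limits of ultrafilters of isometries that tend to the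
    identity pointwise on [Y].  A point of [Env(Y)] is fixed by [L].
    Conversely, if [x] is fixed by [L] and isometries [T] tend to the identity
    on [Y], then [T x] tends to [x] weakly, and for isometries this forces norm
    convergence ([isom_orbit_cvg]).  Otherwise, since every [w] in the
    isometry group preserves distances, one could choose products
    [w_n = T_1 ... T_n] such that each [x_n = w_n x] lies at distance at least
    [e / 3] from the convex hull of its predecessors; the functionals that
    separate [x_n] from this hull then have two different iterated limits along
    [x_0, x_1, ...], which reflexivity excludes.  So [Env(Y)] is the fixed space
    of [L], hence of all contractions fixing [Env(Y)], and (1) follows.

    With local uniform convexity, [T y] is close to [y] as soon as
    [re (phi (T y))] is close to the norm [nr y], where [phi] norms [y].  So if
    [x] is in [Env(Y)], then for some [y_1, ..., y_m] in [Y] every isometry satisfies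
    an inequality [nr (T x - x) <= e + c * deviation T] whose right-hand side is
    affine in [T] ([envelope_deviation]).  It therefore passes to convex
    combinations and to weak operator limits, and shows that every operator in
    the closed convex hull of the isometries that fixes [Y] fixes [Env(Y)].
    Hence [Env(Y)] is the fixed space of the convex semigroup formed by these
    operators ([isometric_envelope_wot]), and the projection it contains is the
    one of (2).  For (3) the semigroup is that of all contractions fixing [Y]
    ([contraction_envelope_fixed]).

    If the dual is strictly convex, a nonzero vector has a unique norming
    functional, which makes a contractive projection determined by its range
    ([contractive_projection_unique]).  Uniqueness follows; for minimality,
    if [q] fixes [Y], then [p \o q] is again a contractive projection onto
    [Env(Y)], so it equals [p]. *)

(** * Real and complex scalars *)

(** What the proof uses of the scalars, stated so that it holds for the reals
    ([re] and [emb] are identities) and for the complex numbers ([re] is the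
    real part).  All norms become real numbers through [re], so that the
    estimates are inequalities between reals.  The last two properties
    are local compactness and the passage from a real-linear functional to a
    scalar-linear one with that real part. *)
Record real_part (R : realType) (K : numFieldType) (re : K -> R)
    (emb : {rmorphism R -> K}) : Prop := RealPart {
  rpD : forall a b, re (a + b) = re a + re b;
  rpZ : forall t a, re (emb t * a) = t * re a;
  rp_emb : forall t, re (emb t) = t;
  emb_ge0 : forall t, (0 <= emb t) = (0 <= t);
  emb_rp : forall a, 0 <= a -> emb (re a) = a;
  rp_le_norm : forall a, re a <= re `|a|;
  rp_ultra : forall (I : Type) (U : set_system I) (f : I -> K) (M : R),
    UltraFilter U -> (\forall i \near U, re `|f i| <= M) ->
    exists l : K, f @ U --> l;
  rp_functional : forall (V : lmodType K) (u : V -> R),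
    (forall x y, u (x + y) = u x + u y) ->
    (forall t x, u (emb t *: x) = t * u x) ->
    exists phi : V -> K, [/\ forall x y, phi (x + y) = phi x + phi y,
       forall a x, phi (a *: x) = a * phi x & forall x, re (phi x) = u x] }.

Lemma ultra_cvg_real (R : realType) (I : Type) (U : set_system I)
    (f : I -> R) (M : R) :
  UltraFilter U -> (\forall i \near U, `|f i| <= M) -> exists l : R, f @ U --> l.
Proof.
move=> UU fM.
have := @segment_compact R (- M) M; rewrite compact_ultra.
have fUU : UltraFilter (f @ U).
  split; first exact: fmap_proper_filter.
  move=> G GF UG; apply/seteqP; split=> // A GA.
  case: (@in_ultra_setVsetC _ _ (f @^-1` A) UU) => // FA.
  have GcA : G (~` A) by apply: UG.
  by have [x []] := filter_ex (filterI GA GcA).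
move=> /(_ _ fUU); case.
  rewrite /fmap /=; apply: filterS fM => i /=; rewrite ler_norml.
  by rewrite in_itv.
by move=> l [_ ?]; exists l.
Qed.

Lemma real_part_real (R : realType) : @real_part R R idfun idfun.
Proof.
split=> //.
- by move=> a; apply: ler_norm.
- move=> I U f M; exact: ultra_cvg_real.
- by move=> V u uD uZ; exists u; split.
Qed.

Lemma real_part_complex (R : realType) :
  @real_part R R[i] (@complex.Re R) (real_complex R).
Proof.
split=> //.
- by case=> ? ? [].
- by move=> t [x y] /=; rewrite mul0r subr0.
- by move=> t; rewrite ler0c.
- by move=> a a0; exact: (RRe_real (ger0_real a0)).
- move=> a; have := normc_ge_Re a; rewrite normc_def lecR /=.
  by apply: le_trans; exact: ler_norm.
- move=> I U f M UU fM.
  have [|a fa] := @ultra_cvg_real R I U (fun i => complex.Re (f i)) M UU.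
    apply: filterS fM => i; apply: le_trans.
    by have := normc_ge_Re (f i); rewrite normc_def lecR.
  have [|b fb] := @ultra_cvg_real R I U (fun i => complex.Im (f i)) M UU.
    apply: filterS fM => i; apply: le_trans.
    have := normc_ge_Re (f i * 'i%C); rewrite normrM ReiNIm normrN.
    suff -> : `|'i%C : R[i]| = 1 by rewrite mulr1 normc_def lecR.
    by rewrite normc_def /= expr0n add0r expr1n sqrtr1.
  exists (a +i* b)%C; apply/cvgrPdist_lt => e e0.
  have He : e = (complex.Re e)%:C%C by rewrite RRe_real // gtr0_real.
  have e0' : 0 < complex.Re e by move: e0; rewrite He ltcR.
  have e2 : 0 < complex.Re e / 2 by rewrite divr_gt0.
  move/cvgrPdist_lt: fa => /(_ _ e2) fa; move/cvgrPdist_lt: fb => /(_ _ e2) fb.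
  apply: filterS2 fa fb => i; case: (f i) => x y /= ha hb.
  rewrite He normc_def /= ltcR.
  apply: le_lt_trans (_ : `|a - x| + `|b - y| < _); last by lra.
  rewrite -[leRHS]ger0_norm ?addr_ge0// -sqrtr_sqr ler_wsqrtr//.
  rewrite [leRHS]sqrrD !real_normK ?num_real//.
  by rewrite -addrA lerD2l lerDr mulrn_wge0// mulr_ge0.
- move=> V u uD uZ.
  (* The only complex-linear functional with real part u. *)
  exists (fun x => (u x -i* u ('i%C *: x))%C); split => //.
  + move=> x y; rewrite scalerDr !uD; simpc.
    by congr (_ +i* _)%C; rewrite opprD.
  + have uZc (a b : R) x : u ((a +i* b)%C *: x) = a * u x + b * u ('i%C *: x).
      rewrite [(a +i* b)%C]complexE /= scalerDl uD (uZ a).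
      by rewrite (mulrC 'i%C) -scalerA (uZ b).
    have uN x : u (- x) = - u x.
      apply: (addrI (u x)); rewrite -uD !subrr.
      by have := uZ 0 0; rewrite scaler0 mul0r.
    move=> [a b] x; rewrite scalerA mulrC -scalerA (uZc a b) (uZc a b).
    have -> : u ('i%C *: ('i%C *: x)) = - u x.
      by rewrite scalerA -expr2 sqr_i scaleN1r uN.
    by simpc; congr (_ +i* _)%C; lra.
Qed.

(** * Separation of convex sets *)

Section HahnBanach.
Context {R : realType} {K : numFieldType} (emb : {rmorphism R -> K}).
Context (V : lmodType K).
Implicit Types (q : V -> R) (D : set V).

(** Only one inequality of positive homogeneity is required; the other one
    follows by scaling back with [t^-1]. *)
Definition sublinear q : Prop :=
  (forall x y, q (x + y) <= q x + q y) /\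
  (forall t x, 0 <= t -> q (emb t *: x) <= t * q x).

Definition real_convex D : Prop := forall u v s t, D u -> D v ->
  0 <= s -> 0 <= t -> s + t = 1 -> D (emb s *: u + emb t *: v).

Lemma le_inf_add (E F : set R) (a : R) : E !=set0 -> F !=set0 ->
  (forall e f, E e -> F f -> a <= e + f) -> a <= inf E + inf F.
Proof.
move=> E0 F0 aEF; rewrite -lerBlDr; apply: lb_le_inf => // e Ee.
rewrite lerBlDr -lerBlDl; apply: lb_le_inf => // f Ff.
by rewrite lerBlDl aEF.
Qed.

Lemma le_mul_inf (E : set R) (t a : R) : E !=set0 -> 0 <= t ->
  (forall e, E e -> a <= t * e) -> a <= t * inf E.
Proof.
move=> E0; rewrite le_eqVlt => /orP[/eqP <-|t0] aE.
  by case: E0 => e Ee; have := aE _ Ee; rewrite !mul0r.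
rewrite mulrC -ler_pdivrMr //; apply: lb_le_inf => // e Ee.
by rewrite ler_pdivrMr // mulrC aE.
Qed.

Lemma sublinear_ge q x : sublinear q -> - q (- x) <= q x.
Proof.
move=> [qD _]; have := qD x (- x); have := qD 0 0.
by rewrite subrr addr0; lra.
Qed.

(** Chains have lower bounds, as Zorn's lemma requires: the values at [x] stay
    above [- p (- x)], so pointwise infima are finite. *)
Lemma sublinear_infimum (A : set (V -> R)) (p : V -> R) : A !=set0 ->
  (forall q1 q2, A q1 -> A q2 -> (forall x, q1 x <= q2 x) \/
     (forall x, q2 x <= q1 x)) ->
  (forall q, A q -> sublinear q /\ (forall x, q x <= p x)) ->
  exists q, [/\ sublinear q, forall x, q x <= p x &
    forall q', A q' -> forall x, q x <= q' x].
Proof.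
move=> [q0 Aq0] Atot AP.
pose E x := [set q x | q in A].
have E0 x : E x !=set0 by exists (q0 x); exists q0.
have Elb x : has_lbound (E x).
  exists (- p (- x)) => _ [q Aq <-].
  have [sq qp] := AP _ Aq.
  by apply: le_trans (sublinear_ge x sq); rewrite lerN2.
have le q x : A q -> inf (E x) <= q x.
  by move=> Aq; apply: ge_inf => //; exists q.
exists (fun x => inf (E x)); split; last by move=> q' Aq' x; exact: le.
- split=> [x y|t x t0].
  + apply: le_inf_add => // _ _ [q1 Aq1 <-] [q2 Aq2 <-].
    have [q12|q21] := Atot _ _ Aq1 Aq2.
    * apply: le_trans (le q1 _ Aq1) _; apply: le_trans ((AP _ Aq1).1.1 _ _) _.
      by rewrite lerD2l.
    * apply: le_trans (le q2 _ Aq2) _; apply: le_trans ((AP _ Aq2).1.1 _ _) _.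
      by rewrite lerD2r.
  + apply: le_mul_inf => // _ [q Aq <-].
    by apply: le_trans (le q _ Aq) _; apply: (AP _ Aq).1.2.
- by move=> x; apply: le_trans (le _ _ Aq0) _; apply: (AP _ Aq0).2.
Qed.

(** The witness [inf (q (x + t u) - t c)], over [t >= 0] and [u] in [D], is the
    largest sublinear functional below [q] with values at most [- c] on the
    opposites of [D]: every linear functional below it is at least [c] on [D].
    It serves twice, for a convex set to be separated from [0], and for a single
    point to prove that minimal sublinear functionals are linear. *)
Lemma sublinear_push q D c : sublinear q -> D !=set0 -> real_convex D ->
  (forall u, D u -> c <= q u) ->
  exists q', [/\ sublinear q', forall x, q' x <= q x &
    forall u, D u -> q' (- u) <= - c].
Proof.
move=> sq [u0 Du0] Dc cD; have [qD qZ] := sq.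
pose E x : set R :=
  [set r | exists t u, [/\ 0 <= t, D u & r = q (x + emb t *: u) - t * c]].
have E0 x : E x !=set0 by exists (q (x + emb 0 *: u0) - 0 * c); exists 0, u0.
have Elb x : has_lbound (E x).
  exists (- q (- x)) => _ [t [u [t0 Du ->]]].
  rewrite lerBrDr addrC lerBlDr.
  have Dt : real_convex D by [].
  have tcq : t * c <= q (emb t *: u).
    have [->|tN0] := eqVneq t 0.
      rewrite mul0r rmorph0 scale0r.
      by have := qD 0 0; rewrite addr0 -lerBlDl subrr.
    apply: le_trans (_ : t * q u <= _); first by rewrite ler_wpM2l ?cD.
    have /(qZ t^-1 (emb t *: u)) : 0 <= t^-1 by rewrite invr_ge0.
    rewrite scalerA -rmorphM mulVf // rmorph1 scale1r.
    by move=> /(ler_wpM2l t0); rewrite mulrA divff // mul1r.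
  apply: le_trans tcq _; have := qD (x + emb t *: u) (- x).
  by rewrite addrAC subrr add0r.
have le x t u : 0 <= t -> D u -> inf (E x) <= q (x + emb t *: u) - t * c.
  by move=> t0 Du; apply: ge_inf => //; exists t, u.
exists (fun x => inf (E x)); split; last 2 first.
- move=> x; have := le x 0 u0 (lexx _) Du0.
  by rewrite rmorph0 scale0r addr0 mul0r subr0.
- move=> u Du; have := le (- u) 1 u ler01 Du.
  rewrite rmorph1 scale1r addNr mul1r => /le_trans; apply.
  rewrite lerBlDr addNr; have := qZ 0 0 (lexx _).
  by rewrite scaler0 mul0r.
split=> [x y|t x t0]; last first.
  apply: le_mul_inf => // _ [s [u [s0 Du ->]]].
  apply: le_trans (le _ (t * s) u (mulr_ge0 t0 s0) Du) _.
  rewrite rmorphM -scalerA -scalerDr mulrBr -mulrA lerD2r.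
  exact: qZ.
apply: le_inf_add => // _ _ [s [u [s0 Du ->]]] [t [v [t0 Dv ->]]].
have [s00|sN0] := eqVneq s 0.
  apply: le_trans (le _ t v t0 Dv) _; rewrite s00 rmorph0 scale0r addr0.
  by have := qD x (y + emb t *: v); rewrite addrA mul0r; lra.
(* (x + s u) + (y + t v) = (x + y) + (s + t) w with w in D. *)
pose w := emb (s / (s + t)) *: u + emb (t / (s + t)) *: v.
have st0 : 0 < s + t by rewrite ltr_pwDl // lt_neqAle eq_sym sN0.
have Dw : D w.
  by apply: Dc; rewrite ?divr_ge0 ?(ltW st0) // -mulrDl divff // gt_eqF.
apply: le_trans (le _ (s + t) w (ltW st0) Dw) _.
have -> : x + y + emb (s + t) *: w = (x + emb s *: u) + (y + emb t *: v).
  rewrite /w scalerDr !scalerA -!rmorphM !(mulrC (s + t)) !divfK ?gt_eqF //.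
  by rewrite addrACA.
by have := qD (x + emb s *: u) (y + emb t *: v); lra.
Qed.

Lemma minimal_sublinear p : sublinear p ->
  exists q, [/\ sublinear q, forall x, q x <= p x &
   forall q', sublinear q' -> (forall x, q' x <= q x) -> forall x, q' x = q x].
Proof.
move=> sp.
pose T := {q : V -> R | sublinear q /\ forall x, q x <= p x}.
pose p0 : T := exist _ p (conj sp (fun=> lexx _)).
pose ord (q1 q2 : T) := `[< forall x, sval q2 x <= sval q1 x >].
have [||A Atot|[q [sq qp]] qmin] := @ZL_preorder T p0 ord.
- by move=> q; apply/asboolP.
- move=> q1 q2 q3 /asboolP h1 /asboolP h2; apply/asboolP => x.
  exact: le_trans (h2 x) (h1 x).
- have [A0|/set0P A0] := eqVneq A set0; first by exists p0; rewrite A0.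
  have [|||q [sq qp qA]] := @sublinear_infimum [set sval q | q in A] p.
  + by case: A0 => q Aq; exists (sval q); exists q.
  + move=> _ _ [q1 A1 <-] [q2 A2 <-].
    by have [/asboolP h|/asboolP h] := Atot _ _ A1 A2; [right|left].
  + by move=> _ [q1 A1 <-]; exact: (svalP q1).
  exists (exist _ q (conj sq qp)) => q1 A1; apply/asboolP => x /=.
  by apply: qA; exists q1.
exists q; split=> // q' sq' q'q x; apply/eqP; rewrite eq_le q'q /=.
have q'p y : q' y <= p y := le_trans (q'q y) (qp y).
have := qmin (exist _ q' (conj sq' q'p)).
by rewrite /ord /= => /(_ (asboolT q'q)) /asboolP; apply.
Qed.

(** A minimal sublinear functional is additive: pushing it down along [- y] at
    the value [q y] cannot change it, so [q (- y) <= - q y]. *)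
Lemma dominated_linear p : sublinear p -> exists q : V -> R,
  [/\ forall x y, q (x + y) = q x + q y, forall t x, q (emb t *: x) = t * q x &
      forall x, q x <= p x].
Proof.
move=> /minimal_sublinear[q [sq qp qmin]].
have [qD qZ] := sq.
have addq x y : q (x + y) = q x + q y.
  apply/eqP; rewrite eq_le qD /=.
  have [|||q' [sq' q'q q'y]] := @sublinear_push q [set y] (q y) sq.
  - by exists y.
  - move=> u v s t -> -> s0 t0 st.
    by rewrite /= -scalerDl -rmorphD st rmorph1 scale1r.
  - by move=> u ->.
  have qN : q (- y) <= - q y.
    by rewrite -(qmin _ sq' q'q); exact: q'y.
  have := qD (x + y) (- y); rewrite addrK.
  lra.
have q0 : q 0 = 0 by have := addq 0 0; rewrite addr0; lra.
have qN x : q (- x) = - q x by have := addq x (- x); rewrite subrr q0; lra.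
have qZp t x : 0 <= t -> q (emb t *: x) = t * q x.
  move=> t0; apply/eqP; rewrite eq_le qZ //=.
  by have := qZ t (- x) t0; rewrite scalerN !qN mulrN lerN2.
exists q; split=> // t x; have [t0|t0] := leP 0 t; first exact: qZp.
have := qZp (- t) x; rewrite oppr_ge0 => /(_ (ltW t0)).
by rewrite rmorphN scaleNr qN mulNr => /oppr_inj.
Qed.

Lemma convex_separation p D c : sublinear p -> D !=set0 -> real_convex D ->
  (forall u, D u -> c <= p u) -> exists q : V -> R,
  [/\ forall x y, q (x + y) = q x + q y, forall t x, q (emb t *: x) = t * q x,
      forall x, q x <= p x & forall u, D u -> c <= q u].
Proof.
move=> sp D0 Dc cD.
have [p' [sp' p'p p'D]] := sublinear_push sp D0 Dc cD.
have [q [qD qZ qp]] := dominated_linear sp'.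
exists q; split=> // [x|u Du]; first exact: le_trans (qp x) (p'p x).
have := le_trans (qp _) (p'D _ Du).
have -> : - u = emb (-1) *: u by rewrite rmorphN1 scaleN1r.
by rewrite qZ mulN1r lerN2.
Qed.

End HahnBanach.

(** * Real-valued norms *)

Section Norms.
Context {R : realType} {K : numFieldType} {re : K -> R}
  {emb : {rmorphism R -> K}} (hS : real_part re emb).
Local Notation nr x := (re `|x|).

Lemma re0 : re 0 = 0.
Proof. by have := rpZ hS 0 0; rewrite mulr0 mul0r. Qed.

Lemma reN a : re (- a) = - re a.
Proof. by have := rpD hS a (- a); rewrite subrr re0; lra. Qed.

Lemma reB a b : re (a - b) = re a - re b.
Proof. by rewrite (rpD hS) reN. Qed.

Lemma re_sum (I : Type) (r : seq I) (P : pred I) (f : I -> K) :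
  re (\sum_(i <- r | P i) f i) = \sum_(i <- r | P i) re (f i).
Proof. exact: (big_morph re (rpD hS) re0). Qed.

Lemma emb_le a b : (emb a <= emb b) = (a <= b).
Proof. by rewrite -subr_ge0 -rmorphB (emb_ge0 hS) subr_ge0. Qed.

Lemma emb_lt a b : (emb a < emb b) = (a < b).
Proof. by rewrite !lt_def emb_le (inj_eq (fmorph_inj emb)). Qed.

Lemma emb_gt0 a : (0 < emb a) = (0 < a).
Proof. by rewrite -(rmorph0 emb) emb_lt. Qed.

Lemma re_gt0 a : 0 < a -> 0 < re a.
Proof. by move=> a0; rewrite -emb_gt0 (emb_rp hS) // ltW. Qed.

Lemma normr_emb a : `|emb a| = emb `|a|.
Proof.
have [a0|/ltW a0] := leP 0 a; first by rewrite !ger0_norm // (emb_ge0 hS).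
rewrite (ler0_norm a0) rmorphN ler0_norm //.
by rewrite -oppr_ge0 -rmorphN (emb_ge0 hS) oppr_ge0.
Qed.

Section NormedZmod.
Context {V : normedZmodType K}.
Implicit Types x y : V.

Lemma emb_nr x : emb (nr x) = `|x|.
Proof. exact: (emb_rp hS). Qed.

Lemma nr_ge0 x : 0 <= nr x.
Proof. by rewrite -(emb_ge0 hS) emb_nr. Qed.

Lemma nrD x y : nr (x + y) <= nr x + nr y.
Proof. by rewrite -emb_le rmorphD !emb_nr ler_normD. Qed.

Lemma nrN x : nr (- x) = nr x.
Proof. by rewrite normrN. Qed.

Lemma nrB x y : nr (x - y) <= nr x + nr y.
Proof. by rewrite -(nrN y) nrD. Qed.

Lemma nr_dist x y : nr (x - y) = nr (y - x).
Proof. by rewrite distrC. Qed.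

Lemma nr0 : nr (0 : V) = 0.
Proof. by rewrite normr0 re0. Qed.

Lemma nr_eq0 x : nr x = 0 -> x = 0.
Proof. by move=> x0; apply/eqP; rewrite -normr_eq0 -emb_nr x0 rmorph0. Qed.

Lemma nr_le0 x : nr x <= 0 -> x = 0.
Proof.
by move=> x0; apply: nr_eq0; apply/eqP; rewrite eq_le x0 nr_ge0.
Qed.

Lemma nr_le_eps x : (forall e, 0 < e -> nr x <= e) -> x = 0.
Proof.
move=> xe; apply: nr_le0; apply/ler_addgt0Pr => e e0.
by rewrite add0r xe.
Qed.

Lemma nr_tri z x y : nr (x - y) <= nr (x - z) + nr (z - y).
Proof. by rewrite -(subrKA z) nrD. Qed.

End NormedZmod.

Lemma nr_le (V W : normedZmodType K) (x : V) (y : W) : (`|x| <= `|y|) = (nr x <= nr y).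
Proof. by rewrite -emb_le !emb_nr. Qed.

Lemma nrZ (V : normedModType K) a (x : V) : nr (a *: x) = nr a * nr x.
Proof. by rewrite normrZ -(emb_nr a) (rpZ hS) emb_nr. Qed.

Lemma nr_emb t : nr (emb t) = `|t|.
Proof. by rewrite normr_emb (rp_emb hS). Qed.

Lemma nrZp (V : normedModType K) t (x : V) : 0 <= t -> nr (emb t *: x) = t * nr x.
Proof. by move=> t0; rewrite nrZ nr_emb ger0_norm. Qed.

Lemma nr1 : nr (1 : K) = 1.
Proof. by rewrite -(rmorph1 emb) nr_emb normr1. Qed.

Lemma norm_re_le a : `|re a| <= nr a.
Proof.
rewrite ler_norml (rp_le_norm hS) andbT.
by have := rp_le_norm hS (- a); rewrite normrN reN; lra.
Qed.

Lemma rotate (a : K) : exists b : K, b * a = `|a| /\ nr b = 1.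
Proof.
have [->|a0] := eqVneq a 0.
  by exists 1; rewrite mulr0 normr0 nr1.
exists (`|a| / a); split; first by rewrite divfK.
rewrite normrM normfV normr_id divff ?normr_eq0 // -(normr1 K).
exact: nr1.
Qed.

Lemma emb_half : emb 2^-1 = 2^-1.
Proof. by rewrite fmorphV rmorph_nat. Qed.

Lemma re_half a : re (2^-1 * a) = re a / 2.
Proof. by rewrite -emb_half (rpZ hS) mulrC. Qed.

Lemma cvg_nrP (V : normedModType K) (I : Type) (F : set_system I) (f : I -> V)
    (l : V) : Filter F ->
  f @ F --> l <-> forall e, 0 < e -> \forall i \near F, nr (f i - l) < e.
Proof.
move=> FF; split.
  move/cvgrPdist_lt => fl e e0; have /fl : 0 < emb e by rewrite emb_gt0.
  by apply: filterS => i; rewrite -emb_nr emb_lt nr_dist.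
move=> fl; apply/cvgrPdist_lt => e e0; have := fl _ (re_gt0 e0).
apply: filterS => i; rewrite nr_dist -emb_lt emb_nr (emb_rp hS) //.
exact: ltW.
Qed.

Lemma cvg_re (I : Type) (F : set_system I) (f : I -> K^o) (l : K^o) : Filter F ->
  f @ F --> l -> (fun i => re (f i)) @ F --> re l.
Proof.
move=> FF /cvg_nrP fl; apply/cvgrPdist_lt => e e0.
apply: filterS (fl _ e0) => i; apply: le_lt_trans.
by rewrite distrC -reB norm_re_le.
Qed.

Lemma nr_cvg_le (V : normedModType K) (I : Type) (F : set_system I) (f : I -> V)
    (l : V) M : ProperFilter F ->
  f @ F --> l -> (\forall i \near F, nr (f i) <= M) -> nr l <= M.
Proof.
move=> FF /cvg_nrP fl fM; apply/ler_addgt0Pr => e e0.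
have [i [fil fiM]] := filter_ex (filterI (fl _ e0) fM).
have := nrD (f i) (l - f i); rewrite subrKC nr_dist; lra.
Qed.

End Norms.

(** * Functionals and weak convergence *)

Section Duality.
Context {R : realType} {K : numFieldType} {re : K -> R}
  {emb : {rmorphism R -> K}} (hS : real_part re emb) {X : normedModType K}.
Local Notation nr x := (re `|x|).
Implicit Types (phi : X -> K^o) (T : X -> X).

Lemma linD (U V : lmodType K) (f : U -> V) x y : linear f ->
  f (x + y) = f x + f y.
Proof. by move=> fl; have := fl 1 x y; rewrite !scale1r. Qed.

Lemma lin0 (U V : lmodType K) (f : U -> V) : linear f -> f 0 = 0.
Proof.
move=> /(linD 0 0); rewrite addr0 => /esym/eqP.
by rewrite -subr_eq0 addrK => /eqP.
Qed.

Lemma linZ (U V : lmodType K) (f : U -> V) a x : linear f -> f (a *: x) = a *: f x.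
Proof. by move=> fl; have := fl a x 0; rewrite (lin0 fl) !addr0. Qed.

Lemma linB (U V : lmodType K) (f : U -> V) x y : linear f ->
  f (x - y) = f x - f y.
Proof. by move=> fl; rewrite (linD _ _ fl) -scaleN1r (linZ _ _ fl) scaleN1r. Qed.

Lemma linear_comp (U V W : lmodType K) (f : V -> W) (g : U -> V) :
  linear f -> linear g -> linear (f \o g).
Proof. by move=> fl gl a x y /=; rewrite gl fl. Qed.

Lemma lin_sum (U V : lmodType K) (f : U -> V) (I : Type) (r : seq I)
  (P : pred I) (F : I -> U) : linear f ->
  f (\sum_(i <- r | P i) F i) = \sum_(i <- r | P i) f (F i).
Proof.
move=> fl; apply: (big_morph f _ (lin0 fl)) => x y; exact: linD.
Qed.

Lemma lipschitz_continuous (V : normedModType K) (f : X -> V) (M : R) :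
  linear f -> (forall x, nr (f x) <= M * nr x) -> continuous f.
Proof.
move=> fl fM x; apply/(cvg_nrP hS) => e e0.
have M0 : 0 < `|M| + 1 by rewrite ltr_wpDl.
have : (fun y : X => y) @ x --> x by exact: cvg_id.
move/(cvg_nrP hS) => /(_ (e / (`|M| + 1)) (divr_gt0 e0 M0)).
apply: filterS => y /=; rewrite ltr_pdivlMr // -linB // => h.
apply: le_lt_trans (fM _) _; apply: le_lt_trans h.
rewrite mulrC ler_wpM2l ?(nr_ge0 hS) //.
by have := ler_norm M; lra.
Qed.

Definition unit_dual phi : Prop :=
  dual_space X phi /\ forall x, nr (phi x) <= nr x.

(** Rotating the argument turns the modulus of a value into a real part. *)
Lemma linear_unit_dual phi : linear phi -> (forall x, re (phi x) <= nr x) ->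
  unit_dual phi.
Proof.
move=> phil phin.
have le1 x : nr (phi x) <= nr x.
  have [b [bphi b1]] := rotate hS (phi x).
  rewrite -bphi -[b * phi x]/(b *: phi x) -linZ //.
  by apply: le_trans (phin _) _; rewrite (nrZ hS) b1 mul1r.
split=> //; split=> //.
by apply: (@lipschitz_continuous _ _ 1) => // x; rewrite mul1r.
Qed.

Lemma dual_bounded phi : dual_space X phi ->
  exists2 M, 0 <= M & forall x, nr (phi x) <= M * nr x.
Proof.
move=> [phil /(_ 0)] /(cvg_nrP hS) /(_ 1 ltr01).
rewrite lin0 // => /nbhs_normP[d /= d0 dphi].
have d0' : 0 < re d := re_gt0 hS d0.
exists (2 / re d) => [|x]; first by rewrite divr_ge0 // ltW.
have [->|x0] := eqVneq x 0.
  by rewrite lin0 // !(nr0 hS) mulr0.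
have nx : 0 < nr x by apply: (re_gt0 hS); rewrite normr_gt0.
have c0 : 0 < re d / (2 * nr x) by rewrite divr_gt0 // mulr_gt0.
have /dphi : ball_ Num.norm 0 d (emb (re d / (2 * nr x)) *: x).
  rewrite /ball_ /= sub0r normrN -(emb_nr hS) (nrZp hS) ?ltW //.
  rewrite -[d](emb_rp hS) ?ltW // (emb_lt hS) (rp_emb hS).
  have -> : re d / (2 * nr x) * nr x = re d / 2 by field; rewrite gt_eqF.
  by rewrite ltr_pdivrMr // ltr_pMr // ltr1n.
rewrite /= subr0 linZ // (nrZp hS) ?(ltW c0) // => h.
have -> : 2 / re d * nr x = (re d / (2 * nr x))^-1.
  by field; rewrite !gt_eqF.
by rewrite -[leRHS]mul1r ler_pdivlMr // mulrC ltW.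
Qed.

Lemma dual_comp phi T : dual_space X phi -> contractions X T ->
  dual_space X (phi \o T : X -> K^o).
Proof.
move=> dphi [Tl Tc]; have [M M0 phiM] := dual_bounded dphi.
have l : linear (phi \o T) by apply: linear_comp => //; exact: dphi.1.
split=> //; apply: (@lipschitz_continuous _ _ M) => // x /=.
by apply: le_trans (phiM _) _; rewrite ler_wpM2l // -(nr_le hS).
Qed.

Lemma dual0 : dual_space X (0 : X -> K^o).
Proof.
split; last exact: cst_continuous.
by move=> a x y; rewrite /= scaler0 addr0.
Qed.

Lemma dualP (a : K) phi psi : dual_space X phi -> dual_space X psi ->
  dual_space X (a *: phi + psi : X -> K^o).
Proof.
move=> dphi dpsi; have [M M0 phiM] := dual_bounded dphi.
have [N N0 psiN] := dual_bounded dpsi.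
have l : linear (a *: phi + psi : X -> K^o).
  move=> b x y; rewrite !fctE dphi.1 dpsi.1 !scalerDr addrACA.
  by rewrite !scalerA (mulrC a b).
split=> //; apply: (@lipschitz_continuous _ _ (nr a * M + N)) => // x /=.
rewrite !fctE; apply: le_trans (nrD hS _ _) _; rewrite (nrZ hS) mulrDl.
by rewrite lerD // -mulrA ler_wpM2l // (nr_ge0 hS).
Qed.

(** Hahn-Banach for a convex set outside an open ball centred at [0]. *)
Lemma separation (D : set X) (c : R) : D !=set0 -> real_convex emb D ->
  (forall u, D u -> c <= nr u) ->
  exists phi, unit_dual phi /\ forall u, D u -> c <= re (phi u).
Proof.
move=> D0 Dc cD.
have [|//|q [qD qZ qn qc]] :=
    @convex_separation R K emb X (fun x => nr x) D c _ D0 Dc.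
- split=> [x y|t x t0]; first exact: (nrD hS).
  by rewrite (nrZp hS).
have [phi [phiD phiZ phiq]] := rp_functional hS qD qZ.
exists phi; split=> [|u Du]; last by rewrite phiq qc.
apply: linear_unit_dual => [a x y|x]; first by rewrite phiD phiZ.
by rewrite phiq.
Qed.

(** The separation of [{x}] from the open ball of radius [nr x]. *)
Lemma norming x : exists phi, unit_dual phi /\ re (phi x) = nr x.
Proof.
have [|||phi [uphi phix]] := @separation [set x] (nr x); first by exists x.
- move=> u v s t -> -> s0 t0 st.
  by rewrite /= -scalerDl -rmorphD st rmorph1 scale1r.
- by move=> u ->.
exists phi; split=> //; apply/eqP; rewrite eq_le phix // andbT.
by apply: le_trans (uphi.2 x); exact: (rp_le_norm hS).
Qed.

Definition weak_cvg (I : Type) (F : set_system I) (v : I -> X) (x : X) : Prop :=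
  forall phi, dual_space X phi -> (fun i => phi (v i)) @ F --> phi x.

Lemma weak_cvg_unique (I : Type) (F : set_system I) (v : I -> X) x y :
  ProperFilter F -> weak_cvg F v x -> weak_cvg F v y -> x = y.
Proof.
move=> FF vx vy; apply/eqP; rewrite -subr_eq0; apply/eqP; apply: (nr_eq0 hS).
have [phi [[dphi _] <-]] := norming (x - y).
have <- : re 0 = 0 := re0 hS.
congr re; rewrite linB; last exact: dphi.1.
apply/eqP; rewrite subr_eq0; apply/eqP.
exact: (cvg_unique _ (vx _ dphi) (vy _ dphi)).
Qed.

Lemma weak_cvg_cst (I : Type) (F : set_system I) x : Filter F ->
  weak_cvg F (fun=> x) x.
Proof. by move=> FF phi dphi; exact: cvg_cst. Qed.

Lemma cvg_weak (I : Type) (F : set_system I) (v : I -> X) x : Filter F ->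
  v @ F --> x -> weak_cvg F v x.
Proof.
move=> FF vx phi [_ phic]; apply: (cvg_comp _ _ vx); exact: phic.
Qed.

Lemma weak_cvg_lin (I : Type) (F : set_system I) (v w : I -> X) x y a :
  Filter F -> weak_cvg F v x -> weak_cvg F w y ->
  weak_cvg F (fun i => a *: v i + w i) (a *: x + y).
Proof.
move=> FF vx wy phi dphi; rewrite dphi.1.
have -> : (fun i => phi (a *: v i + w i)) =
    (fun i => a *: phi (v i) + phi (w i)).
  by apply/funext => i; rewrite dphi.1.
apply: (@cvgD K (K^o)); last exact: wy.
by apply: (@cvgZ K (K^o)); [exact: cvg_cst|exact: vx].
Qed.

Lemma weak_cvg_comp (I : Type) (F : set_system I) (v : I -> X) x T :
  contractions X T -> weak_cvg F v x -> weak_cvg F (T \o v) (T x).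
Proof. by move=> cT vx phi dphi; exact: (vx _ (dual_comp dphi cT)). Qed.

Lemma weak_cvg_re (I : Type) (F : set_system I) (v : I -> X) x phi : Filter F ->
  dual_space X phi -> weak_cvg F v x -> (fun i => re (phi (v i))) @ F --> re (phi x).
Proof. by move=> FF dphi vx; apply: (cvg_re hS); exact: vx. Qed.

Lemma weak_cvg_le (I : Type) (F : set_system I) (v : I -> X) x M :
  ProperFilter F -> weak_cvg F v x -> (\forall i \near F, nr (v i) <= M) ->
  nr x <= M.
Proof.
move=> FF vx vM; have [phi [uphi <-]] := norming x.
apply: le_trans (rp_le_norm hS _) _.
apply: (@nr_cvg_le _ _ _ _ hS (K^o) _ _ _ _ M FF (vx _ uphi.1)).
by apply: filterS vM => i; apply: le_trans; exact: uphi.2.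
Qed.

End Duality.

Arguments unit_dual {R K} re {X} phi.

(** * Compactness in reflexive spaces *)

Section Reflexivity.
Context {R : realType} {K : numFieldType} {re : K -> R}
  {emb : {rmorphism R -> K}} (hS : real_part re emb) {X : normedModType K}.
Local Notation nr x := (re `|x|).
Implicit Types (phi : X -> K^o) (T : X -> X).

(** Bounded sets of complex numbers may lack suprema; the set defining the dual
    norm has one because it consists of nonnegative reals, and upper bounds of
    it are then real as well. *)
Lemma dual_norm_supremum phi : dual_space X phi -> exists s,
  [/\ dual_norm phi = emb s, forall x, nr x <= 1 -> nr (phi x) <= s &
      forall M, (forall x, nr x <= 1 -> nr (phi x) <= M) -> s <= M].
Proof.
move=> dphi; have [M M0 phiM] := dual_bounded hS dphi.
pose E := [set nr (phi x) | x in [set x : X | nr x <= 1]].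
have x01 : nr (0 : X) <= 1 by rewrite (nr0 hS).
have E0 : E !=set0 by exists (nr (phi 0)), 0.
have Eub : has_ubound E.
  exists M => _ [x /= x1 <-]; apply: le_trans (phiM _) _.
  by rewrite -[leRHS]mulr1 ler_wpM2l.
have sE x : nr x <= 1 -> nr (phi x) <= sup E.
  by move=> x1; apply: ub_le_sup => //; exists x.
have sM N : (forall x, nr x <= 1 -> nr (phi x) <= N) -> sup E <= N.
  by move=> phiN; apply: ge_sup => // _ [x x1 <-]; exact: phiN.
exists (sup E); split=> //.
have nr1E (x : X) : (`|x| <= 1) = (nr x <= 1).
  by rewrite -(emb_nr hS) -(rmorph1 emb) (emb_le hS) (rp_emb hS).
have sup_emb : supremums [set `|phi x| | x in [set x : X | `|x| <= 1]] (emb (sup E)).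
  split=> [_ [x /= x1 <-]|b bE].
    by rewrite -(emb_nr hS (phi x)) (emb_le hS) sE // -nr1E.
  have b0 : 0 <= b.
    by apply: le_trans (normr_ge0 (phi 0)) _; apply: bE; exists 0; rewrite /= ?normr0.
  rewrite -(emb_rp hS b0) (emb_le hS); apply: sM => x x1.
  rewrite -(emb_le hS) (emb_rp hS b0) (emb_nr hS); apply: bE.
  by exists x => //=; rewrite nr1E.
rewrite /dual_norm /supremum ifF.
  by case: xgetP => [y _ ys|/(_ _ sup_emb)//]; exact: is_subset1_supremums ys sup_emb.
by apply/negP => /eqP/seteqP[h _]; apply: (h `|phi 0|); exists 0; rewrite /= ?normr0.
Qed.

Lemma le_dual_norm phi x : dual_space X phi ->
  nr (phi x) <= re (dual_norm phi) * nr x.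
Proof.
move=> dphi; have [s [-> phis _]] := dual_norm_supremum dphi.
rewrite (rp_emb hS); have [->|x0] := eqVneq x 0.
  by rewrite (lin0 dphi.1) !(nr0 hS) mulr0.
have nx : 0 < nr x by apply: (re_gt0 hS); rewrite normr_gt0.
have := phis (emb (nr x)^-1 *: x).
rewrite (linZ _ _ dphi.1) !(nrZp hS) ?invr_ge0 ?(ltW nx) //.
rewrite [(nr x)^-1 * nr x]mulVf ?gt_eqF //.
by rewrite mulrC ler_pdivrMr //; apply.
Qed.

Lemma dual_norm_ge0 phi : dual_space X phi -> 0 <= re (dual_norm phi).
Proof.
move=> /dual_norm_supremum[s [-> phis _]]; rewrite (rp_emb hS).
by apply: le_trans (phis 0 _); rewrite ?(nr0 hS) // (nr_ge0 hS).
Qed.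

Lemma dual_norm_emb phi : dual_space X phi -> emb (re (dual_norm phi)) = dual_norm phi.
Proof. by move=> /dual_norm_supremum[s [-> _ _]]; rewrite (rp_emb hS). Qed.

Lemma dual_norm_le1 phi : unit_dual re phi -> re (dual_norm phi) <= 1.
Proof.
move=> [dphi phi1]; have [s [-> _ smin]] := dual_norm_supremum dphi.
by rewrite (rp_emb hS); apply: smin => x; apply: le_trans.
Qed.

(** The limits of [phi (v i)], for [phi] in the dual, form a bounded linear
    functional of [phi]; reflexivity represents it by a vector. *)
Lemma ultra_weak_cvg (I : Type) (U : set_system I) (v : I -> X) (M : R) :
  reflexive_space X -> UltraFilter U -> (\forall i \near U, nr (v i) <= M) ->
  exists x, weak_cvg U v x.
Proof.
move=> hrefl UU vM.
have M0 : 0 <= M.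
  have [j] := filter_ex vM; apply: le_trans; exact: (nr_ge0 hS).
have /choice[Phi PhiP] : forall phi, exists l : K^o, dual_space X phi ->
    (fun i => phi (v i)) @ U --> l.
  move=> phi; have [dphi|nd] := pselect (dual_space X phi); last by exists 0 => /nd.
  have [N N0 phiN] := dual_bounded hS dphi.
  have [|l phil] := rp_ultra hS (f := fun i => phi (v i)) (M := N * M) UU.
    apply: filterS vM => i vi; apply: le_trans (phiN _) _.
    by rewrite ler_wpM2l.
  by exists l.
have [||x xP] := hrefl Phi.
- move=> a phi psi dphi dpsi.
  have lim : (fun i => (a *: phi (v i) : K^o) + psi (v i)) @ U -->
      (a *: (Phi phi : K^o) + Phi psi).
    apply: (@cvgD K (K^o)); last exact: PhiP.
    by apply: (@cvgZ K (K^o)); [exact: cvg_cst|exact: PhiP].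
  exact: (cvg_unique _ (PhiP _ (dualP hS a dphi dpsi)) lim).
- exists (emb M) => phi dphi.
  rewrite -(emb_nr hS (Phi phi)) -(dual_norm_emb dphi) -rmorphM (emb_le hS).
  apply: (@nr_cvg_le _ _ _ _ hS (K^o) _ _ _ _ _ _ (PhiP _ dphi)).
  apply: filterS vM => i vi; apply: le_trans (le_dual_norm _ dphi) _.
  by rewrite mulrC ler_wpM2r // dual_norm_ge0.
- by exists x => phi dphi; rewrite -xP //; exact: PhiP.
Qed.

(** Weak-star compactness of the dual ball. *)
Lemma ultra_dual_cvg (I : Type) (U : set_system I) (phi : I -> X -> K^o) :
  UltraFilter U -> (forall i, unit_dual re (phi i)) ->
  exists psi, unit_dual re psi /\ forall x, (fun i => phi i x) @ U --> psi x.
Proof.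
move=> UU uphi.
have /choice[psi psiP] : forall x, exists l : K^o, (fun i => phi i x) @ U --> l.
  move=> x; apply: (rp_ultra hS (M := nr x)).
  by apply: filterE => i; exact: (uphi i).2.
exists psi; split=> //.
have psil : linear psi.
  move=> a x y.
  have lim : (fun i => (a *: phi i x : K^o) + phi i y) @ U -->
      (a *: (psi x : K^o) + psi y).
    apply: (@cvgD K (K^o)); last exact: psiP.
    by apply: (@cvgZ K (K^o)); [exact: cvg_cst|exact: psiP].
  have phiE : (fun i => phi i (a *: x + y)) =
      (fun i => (a *: phi i x : K^o) + phi i y).
    by apply/funext => i; rewrite (uphi i).1.1.
  have := psiP (a *: x + y); rewrite phiE => lim'.
  exact: (cvg_unique _ lim' lim).
apply: (linear_unit_dual hS) => // x; apply: le_trans (rp_le_norm hS _) _.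
apply: (@nr_cvg_le _ _ _ _ hS (K^o) _ _ _ _ _ _ (psiP x)).
by apply: filterE => i; exact: (uphi i).2.
Qed.

Definition wot_cvg (I : Type) (F : set_system I) (S : I -> X -> X) T : Prop :=
  forall x, weak_cvg F (S^~ x) (T x).

Lemma nr_contraction T : linear T -> (forall x, nr (T x) <= nr x) -> contractions X T.
Proof. by move=> Tl Tn; split=> // x; rewrite (nr_le hS). Qed.

Lemma contraction_nr T x : contractions X T -> nr (T x) <= nr x.
Proof. by move=> [_ Tn]; rewrite -(nr_le hS). Qed.

Lemma wot_cvg_contraction (I : Type) (F : set_system I) (S : I -> X -> X) T :
  ProperFilter F -> (\forall i \near F, contractions X (S i)) -> wot_cvg F S T ->
  contractions X T.
Proof.
move=> FF cS ST; apply: nr_contraction => [a x y|x].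
  apply: (weak_cvg_unique hS FF (ST _)).
  have H := weak_cvg_lin (a := a) _ (ST x) (ST y).
  move=> phi dphi; apply: cvg_trans (H _ phi dphi).
  apply: near_eq_cvg; apply: filterS cS => i [Sl _].
  by rewrite /= Sl.
apply: (weak_cvg_le hS FF (ST x)); apply: filterS cS => i.
exact: contraction_nr.
Qed.

Lemma ultra_wot_cvg (I : Type) (U : set_system I) (S : I -> X -> X) :
  reflexive_space X -> UltraFilter U -> (\forall i \near U, contractions X (S i)) ->
  exists T, contractions X T /\ wot_cvg U S T.
Proof.
move=> hrefl UU cS.
have /choice[T ST] : forall x, exists y, weak_cvg U (S^~ x) y.
  move=> x; apply: (ultra_weak_cvg (M := nr x) hrefl UU).
  by apply: filterS cS => i; exact: contraction_nr.
by exists T; split=> //; exact: wot_cvg_contraction ST.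
Qed.

End Reflexivity.

(** * Fixed spaces of convex semigroups *)

Section FixedSpace.
Context {R : realType} {K : numFieldType} {re : K -> R}
  {emb : {rmorphism R -> K}} (hS : real_part re emb) {X : normedModType K}.
Local Notation nr x := (re `|x|).
Implicit Types (S T p : X -> X) (C : set (X -> X)).

Definition fixed_space C : set X := [set x | forall T, C T -> T x = x].

Record convex_semigroup C : Prop := ConvexSemigroup {
  csg_contraction : C `<=` contractions X;
  csg_id : C id;
  csg_comp : forall S T, C S -> C T -> C (S \o T);
  csg_convex : forall S T s t, C S -> C T -> 0 <= s -> 0 <= t -> s + t = 1 ->
    C (fun x => emb s *: S x + emb t *: T x);
  csg_closed : forall (I : Type) (U : set_system I) (S : I -> X -> X) T,
    UltraFilter U -> (\forall i \near U, C (S i)) -> wot_cvg U S T -> C T }.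

(** Both norms are forced to equal that of the midpoint; after rescaling to the
    unit sphere, strict convexity applies. *)
Lemma midpoint_eq (u v : X) : strictly_convex X ->
  nr u <= nr (2^-1 *: (u + v)) -> nr v <= nr (2^-1 *: (u + v)) -> u = v.
Proof.
move=> hX; set m := 2^-1 *: _ => um vm.
have nm : nr m = nr (u + v) / 2.
  by rewrite /m -(@emb_half R K emb) (nrZp hS) ?invr_ge0 // mulrC.
have [m0|m0] := eqVneq m 0.
  move: um vm; rewrite m0 (nr0 hS) => um vm.
  by rewrite (nr_le0 hS um) (nr_le0 hS vm).
have r0 : 0 < nr m by apply: (re_gt0 hS); rewrite normr_gt0.
have uvm : nr u = nr m /\ nr v = nr m by have := nrD hS u v; split; lra.
have e0 : emb (nr m)^-1 != 0 by rewrite fmorph_eq0 invr_eq0 gt_eqF.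
apply: contrapT => uv.
have n1 (w : X) : nr w = nr m -> `|emb (nr m)^-1 *: w| = 1.
  move=> wm; rewrite -(emb_nr hS) (nrZp hS) ?invr_ge0 ?(ltW r0) // wm.
  by rewrite [_ * _]mulVf ?gt_eqF // rmorph1.
have := hX _ _ I I (n1 u uvm.1) (n1 v uvm.2).
rewrite -scalerDr scalerA mulrC -scalerA -/m n1 // ltxx => H.
by have : false by apply: H => /(scalerI e0).
Qed.

Lemma midpoint_fixed S T x : strictly_convex X -> contractions X S ->
  contractions X T -> 2^-1 *: (S x + T x) = x -> S x = x /\ T x = x.
Proof.
move=> hX cS cT STx.
have STE : S x = T x.
  by apply: midpoint_eq => //; rewrite STx; exact: (contraction_nr hS).
move: STx; rewrite -STE -[S x + S x]mulr2n -[S x *+ 2]scaler_nat.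
by rewrite scalerA mulVf // scale1r.
Qed.

(** The Cesaro means [A_n] of [T] satisfy
    [T A_n x - A_n x = (T^(n+1) x - x) / (n+1)], which tends to [0]; a weak limit
    of them is fixed by [T]. *)
Lemma ergodic_limit C T : reflexive_space X -> convex_semigroup C -> C T ->
  exists p, C p /\ forall x, T (p x) = p x.
Proof.
move=> hrefl hC CT; have [Tl Tc] := csg_contraction hC CT.
(* The recursion (n+2) A_(n+1) = id + (n+1) T A_n, which keeps A_n in C by
   convexity and stability under composition. *)
pose A := fix A n : X -> X := if n is m.+1 then
  fun x => emb (m.+2%:R^-1) *: x + emb (m.+1%:R / m.+2%:R) *: T (A m x) else id.
have CA n : C (A n).
  elim: n => [|n IH] /=; first exact: csg_id.
  apply: (csg_convex hC (S := id) (T := T \o A n)).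
  - exact: csg_id.
  - exact: csg_comp.
  - by rewrite invr_ge0.
  - by rewrite divr_ge0.
  - have n2 : n.+2%:R = 1 + n.+1%:R :> R by rewrite -[LHS]natr1 addrC.
    by rewrite -[X in X + _]mul1r -mulrDl -n2 divff // pnatr_eq0.
have AT n x : emb n.+1%:R *: (T (A n x) - A n x) = iter n.+1 T x - x.
  elim: n => [|n IH]; first by rewrite rmorph1 scale1r.
  have AE : emb n.+2%:R *: A n.+1 x = x + emb n.+1%:R *: T (A n x).
    rewrite /= scalerDr !scalerA -!rmorphM divff ?pnatr_eq0 // rmorph1 scale1r.
    by rewrite mulrCA divff ?pnatr_eq0 // mulr1.
  rewrite scalerBr -(linZ _ _ Tl) AE (linD _ _ Tl) (linZ _ _ Tl).
  rewrite opprD addrACA -scalerBr -(linB _ _ Tl) -(linZ _ _ Tl) IH (linB _ _ Tl).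
  by rewrite addrC addrA subrK.
have ATn n x : nr (T (A n x) - A n x) <= 2 * nr x / n.+1%:R.
  rewrite ler_pdivlMr // mulrC -(nrZp hS) // AT.
  apply: le_trans (nrB hS _ _) _; rewrite mulr_natl mulr2n lerD2r.
  elim: n.+1 => //= m; apply: le_trans.
  exact: (contraction_nr hS _ (csg_contraction hC CT)).
have [U [UU NU]] := ultraFilterLemma (@eventually_filter).
have UC : \forall n \near U, C (A n) by exact: filterE.
have [p [cp pA]] := ultra_wot_cvg hS hrefl UU
  (filterS (fun n => @csg_contraction _ hC (A n)) UC).
exists p; split; first exact: (csg_closed hC UU UC pA).
move=> x; apply/eqP; rewrite -subr_eq0; apply/eqP.
have wTA := weak_cvg_comp hS (csg_contraction hC CT) (pA x).
have UP : ProperFilter U by exact: ultra_proper.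
have := weak_cvg_lin (a := -1) (@filter_filter _ _ UP) (pA x) wTA.
rewrite scaleN1r addrC => wd.
apply: (weak_cvg_unique hS UP wd).
apply: cvg_weak; apply/(cvg_nrP hS) => e e0.
apply: NU; near=> n; rewrite subr0 scaleN1r addrC /=.
apply: le_lt_trans (ATn _ _) _; rewrite ltr_pdivrMr // -ltr_pdivrMl //.
apply: (@lt_le_trans _ _ n%:R); last by rewrite ler_nat.
by near: n; exact: nbhs_infty_gtr.
Unshelve. all: by end_near. Qed.

(** For each [T] in [C] the [q] in [C] with [T \o q = q] form a nonempty set by
    the ergodic argument.  These sets generate a filter, because the one of
    [(S + T) / 2] lies in those of [S] and [T].  A weak operator limit along a
    finer ultrafilter takes its values in the fixed space, and it fixes that
    space since it belongs to [C]. *)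
Lemma fixed_space_projection C : reflexive_space X -> strictly_convex X ->
  convex_semigroup C ->
  exists p, [/\ C p, projection p & range p = fixed_space C].
Proof.
move=> hrefl hX hC.
pose B T : set (X -> X) := [set q | C q /\ forall x, T (q x) = q x].
have BF : ProperFilter (filter_from C B).
  apply: filter_from_proper; last by move=> T CT; exact: ergodic_limit.
  apply: filter_from_filter; first by exists id; exact: csg_id.
  move=> S T CS CT.
  exists (fun x => emb 2^-1 *: S x + emb 2^-1 *: T x).
    by apply: csg_convex => //; rewrite ?invr_ge0 //; lra.
  move=> q [Cq qfix].
  have STq x : S (q x) = q x /\ T (q x) = q x.
    apply: midpoint_fixed => //; [exact: csg_contraction CS|exact: csg_contraction CT|].
    by rewrite -[RHS]qfix scalerDr -(@emb_half R K emb).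
  by split; split=> // x; have [] := STq x.
have [U [UU BU]] := ultraFilterLemma BF.
have UB T : C T -> U (B T) by move=> CT; apply: BU; exists T.
have UC : U C by apply: filterS (UB _ (csg_id hC)) => q [].
have [p [cp pU]] := ultra_wot_cvg (S := id) hS hrefl UU
  (filterS (csg_contraction hC) UC).
have Cp : C p by exact: (csg_closed hC UU UC pU).
have pfix x : fixed_space C (p x).
  move=> T CT; have cT := csg_contraction hC CT.
  apply: (weak_cvg_unique hS (@ultra_proper _ _ UU) (weak_cvg_comp hS cT (pU x))).
  move=> phi dphi; apply: cvg_trans (pU x _ dphi).
  apply: near_eq_cvg; apply: filterS (UB _ CT) => q [_ qT] /=.
  by rewrite qT.
exists p; split=> //.
  split; first exact: cp.1.
  by apply/funext => x /=; exact: pfix.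
apply/seteqP; split=> [_ [x _ <-]|x xfix]; first exact: pfix.
by exists x => //; exact: xfix.
Qed.

End FixedSpace.

Arguments convex_semigroup {R K} emb {X} C.

(** * Weak and norm convergence on orbits of isometries *)

Section IsometricOrbits.
Context {R : realType} {K : numFieldType} {re : K -> R}
  {emb : {rmorphism R -> K}} (hS : real_part re emb) {X : normedModType K}.
Local Notation nr x := (re `|x|).

Definition hull n (x : 'I_n -> X) : set X :=
  [set u | exists a : 'I_n -> R, [/\ forall i, 0 <= a i, \sum_i a i = 1 &
     u = \sum_i emb (a i) *: x i]].

Lemma hull_convex n (x : 'I_n -> X) : real_convex emb (hull x).
Proof.
move=> _ _ s t [a [a0 a1 ->]] [b [b0 b1 ->]] s0 t0 st.
exists (fun i => s * a i + t * b i); split.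
- by move=> i; rewrite addr_ge0 // mulr_ge0.
- by rewrite big_split -!mulr_sumr a1 b1 !mulr1.
- rewrite !scaler_sumr -big_split; apply: eq_bigr => i _ /=.
  by rewrite !scalerA -!rmorphM -scalerDl -rmorphD.
Qed.

(** The coefficients are bounded reals, so they converge along [U]. *)
Lemma hull_compact n (x : 'I_n -> X) (I : Type) (U : set_system I) (u : I -> X) :
  UltraFilter U -> (forall i, hull x (u i)) -> exists v : X, u @ U --> v.
Proof.
move=> UU /choice[a ax].
have a01 i j : 0 <= a i j <= 1.
  have [a0 a1 _] := ax i; rewrite a0 -a1 (bigD1 j) //= lerDl sumr_ge0 //.
have /choice[b ab] : forall j, exists l : R, (fun i => a i j) @ U --> l.
  move=> j; apply: (@ultra_cvg_real _ _ _ _ 1); apply: filterE => i.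
  by rewrite ger0_norm; case/andP: (a01 i j).
exists (\sum_j emb (b j) *: x j).
have -> : u = (fun i => \sum_j emb (a i j) *: x j).
  by apply/funext => i; have [_ _] := ax i.
apply: cvg_big => [|j _]; first exact: add_continuous.
apply/(cvg_nrP hS) => e e0.
have d0 : 0 < nr (x j) + 1 by rewrite ltr_wpDl // (nr_ge0 hS).
move/cvgrPdist_lt: (ab j) => /(_ _ (divr_gt0 e0 d0)).
apply: filterS => i; rewrite ltr_pdivlMr // => h.
rewrite -scalerBl -rmorphB (nrZ hS) (nr_emb hS) distrC.
apply: le_lt_trans h; rewrite ler_wpM2l //; lra.
Qed.

(** If points [u i] of the hull stayed within [e / 3] of [v i], their norm limit
    [w] would lie within [e / 3] of the weak limit [y], and [v i] would come
    closer to [y] than [e]. *)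
Lemma weak_escape n (x : 'I_n -> X) (I : Type) (U : set_system I) (v : I -> X) y e :
  UltraFilter U -> 0 < e -> weak_cvg U v y ->
  (\forall i \near U, e <= nr (v i - y)) ->
  \forall i \near U, forall u, hull x u -> e / 3 <= nr (v i - u).
Proof.
move=> UU e0 vy ve.
have UP : ProperFilter U by exact: ultra_proper.
case: (in_ultra_setVsetC
  [set i | forall u, hull x u -> e / 3 <= nr (v i - u)] UU) => // near_hull.
exfalso.
have [[u0 hu0]|nohull] := pselect (exists u, hull x u); last first.
  have [j jn] := filter_ex near_hull.
  by apply: jn => u hu; exfalso; apply: nohull; exists u.
have /choice[u uP] : forall i, exists w, hull x w /\
    ((~` [set i | forall u, hull x u -> e / 3 <= nr (v i - u)]) i ->
      nr (v i - w) < e / 3).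
  move=> i; have [h|h] := pselect (forall u, hull x u -> e / 3 <= nr (v i - u)).
    by exists u0; split.
  have /existsNP[w /not_implyP[hw /negP]] := h.
  by rewrite -ltNge => lw; exists w.
have [w uw] := hull_compact UU (fun i => (uP i).1).
have e3 : 0 < e / 3 by rewrite divr_gt0.
have wy : nr (y - w) <= e / 3.
  apply: (@weak_cvg_le _ _ _ _ hS _ _ U (fun i => -1 *: u i + v i) _ _ UP).
    have := weak_cvg_lin (a := -1) (@filter_filter _ _ UP)
      (cvg_weak (@filter_filter _ _ UP) uw) vy.
    by rewrite scaleN1r addrC.
  apply: filterS near_hull => i /(uP i).2 /ltW.
  by rewrite scaleN1r addrC.
move/(cvg_nrP hS): uw => /(_ (e / 3)) uw'.
have [j [[hj uj] vj]] := filter_ex (filterI (filterI near_hull (uw' e3)) ve).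
have := (uP j).2 hj; have := nr_tri hS (u j) (v j) y; have := nr_tri hS w (u j) y.
rewrite (nr_dist w y); lra.
Qed.

Lemma separate_from_hull n (x : 'I_n -> X) v c :
  (forall u, hull x u -> c <= nr (v - u)) ->
  exists phi, unit_dual re phi /\ forall i, re (phi (x i)) + c <= re (phi v).
Proof.
move=> xc.
have xi i : hull x (x i).
  exists (fun j => (j == i)%:R); split => //.
    rewrite (bigD1 i) //= eqxx big1 ?addr0 // => j /negbTE -> //.
  rewrite (bigD1 i) //= eqxx rmorph1 scale1r big1 ?addr0 // => j /negbTE ->.
  by rewrite rmorph0 scale0r.
have [/forallP noI|] := boolP [forall i : 'I_n, false].
  have [phi [uphi _]] := norming hS v.
  by exists phi; split=> // i; have := noI i.
rewrite negb_forall => /existsP[i0 _].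
have [|||phi [uphi phic]] := @separation _ _ _ _ hS X [set v - u | u in hull x] c.
- by exists (v - x i0), (x i0).
- move=> _ _ s t [u1 h1 <-] [u2 h2 <-] s0 t0 st.
  exists (emb s *: u1 + emb t *: u2); first exact: hull_convex.
  rewrite !scalerBr addrACA -scalerDl -rmorphD st rmorph1 scale1r.
  by rewrite -opprD.
- by move=> _ [u hu <-]; exact: xc.
exists phi; split=> // i.
have := phic _ (ex_intro2 _ _ _ (xi i) erefl).
by rewrite (linB _ _ uphi.1.1) (reB hS); lra.
Qed.

(** Dependent choice in which a choice may depend on all the previous ones; the
    induction hypothesis is that these were made correctly. *)
Lemma history_choice (T : Type) (t0 : T) (Q : seq T -> T -> Prop) :
  (forall s, (forall i, (i < size s)%N -> Q (take i s) (nth t0 s i)) ->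
     exists y, Q s y) ->
  exists f : nat -> T, forall n, Q (mkseq f n) (f n).
Proof.
move=> step.
have /choice[g gP] : forall s, exists y,
    (forall i, (i < size s)%N -> Q (take i s) (nth t0 s i)) -> Q s y.
  move=> s; have [/step[y Qy]|no] := pselect (forall i, (i < size s)%N ->
    Q (take i s) (nth t0 s i)); first by exists y.
  by exists t0 => /no.
pose F := fix F n := if n is m.+1 then rcons (F m) (g (F m)) else [::].
have FE n : F n = mkseq (fun m => g (F m)) n.
  by elim: n => //= n IH; rewrite mkseqS -IH.
exists (fun m => g (F m)); elim/ltn_ind => n IH.
rewrite -FE; apply: gP => i; rewrite FE size_mkseq => ltin.
by rewrite nth_mkseq // -map_take take_iota (minn_idPl (ltnW ltin)); exact: IH.
Qed.

Lemma isom_contraction T : Isom X T -> contractions X T.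
Proof. by move=> [Tl Tn _]; split=> // x; rewrite Tn. Qed.

Lemma isom_id : Isom X id.
Proof. by split=> //; apply/seteqP; split=> // x _; exists x. Qed.

Lemma isom_comp S T : Isom X S -> Isom X T -> Isom X (S \o T).
Proof.
move=> [Sl Sn Sr] [Tl Tn Tr]; split.
- exact: linear_comp.
- by move=> x /=; rewrite Sn Tn.
- apply/seteqP; split=> // x _.
  have : range S x by rewrite Sr.
  case=> y _ <-; have : range T y by rewrite Tr.
  by case=> z _ <-; exists z.
Qed.

(** Suppose [T x] tends weakly to [x] but stays at distance [e] from it.  Choose
    isometries [w_0 = id] and [w_(n+1) = w_n \o T_n] together with functionals
    [phi_n] in the dual unit ball such that, with [x_n = w_n x],
    [re (phi_j x_i) + e / 4 < re (phi_j x_k)] whenever [i < j <= k].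
    - The case [j = k] is possible because [w_n] is isometric: [w_n (T x)]
      tends weakly to [w_n x] and stays at distance [e] from it, so it leaves
      the compact hull of [x_0, ..., x_n], from which [phi_(n+1)] separates it.
    - The cases [j < k] are finitely many strict inequalities that hold at
      [w_n x], hence at [w_n (T x)] for [T] weakly close to the identity at [x].
    Let [z] and [psi] be limits of [x_n] and [phi_n] along an ultrafilter on the
    integers.  Letting [k], then [j], then [i] tend to infinity yields
    [re (psi z) + e / 4 <= re (psi z)], which is absurd. *)
Lemma isom_orbit_cvg (U : set_system (X -> X)) x : reflexive_space X ->
  UltraFilter U -> U (Isom X) -> weak_cvg U (fun T => T x) x ->
  (fun T : X -> X => T x) @ U --> x.
Proof.
move=> hrefl UU UI Ux; apply: contrapT => notcvg.
have UP : ProperFilter U by exact: ultra_proper.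
have [e e0 eU] : exists2 e, 0 < e & \forall T \near U, e <= nr (T x - x).
  apply: contrapT => noe; apply: notcvg; apply/(cvg_nrP hS) => e e0.
  have [//|h] := in_ultra_setVsetC [set T : X -> X | nr (T x - x) < e] UU.
  exfalso; apply: noe; exists e => //; apply: filterS h => T /negP.
  by rewrite -leNgt.
pose t0 : (X -> X) * (X -> K^o) := (id, 0).
pose pt (s : seq ((X -> X) * (X -> K^o))) i := (nth t0 s i).1 x.
pose fn (s : seq ((X -> X) * (X -> K^o))) j := (nth t0 s j).2.
pose Q s (y : (X -> X) * (X -> K^o)) := [/\ Isom X y.1, unit_dual re y.2,
  forall i j, (i < j)%N -> (j < size s)%N ->
     re (fn s j (pt s i)) + e / 4 < re (fn s j (y.1 x)) &
  forall i, (i < size s)%N -> re (y.2 (pt s i)) + e / 4 < re (y.2 (y.1 x))].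
(* A history s lists the pairs (w_i, phi_i); pt and fn read off x_i and phi_i.
   The value e / 4 rather than e / 3 makes the inequalities strict. *)
have [s sQ|f fQ] := @history_choice _ t0 Q.
  have [s0|[m sm]] : size s = 0%N \/ exists m, size s = m.+1.
    by case: (size s) => [|m]; [left|right; exists m].
    exists t0; split; rewrite ?s0 //; first exact: isom_id.
    by split=> [|v] /=; [exact: dual0|rewrite (nr0 hS) (nr_ge0 hS)].
  have lm : (m < size s)%N by rewrite sm.
  pose w := (nth t0 s m).1.
  have [wI _ _ _] := sQ m lm.
  have sw i j : (i < j)%N -> (j < size s)%N ->
      re (fn s j (pt s i)) + e / 4 < re (fn s j (w x)).
    move=> ij; rewrite sm ltnS leq_eqVlt => /orP[/eqP jm|jm].
      move: ij; rewrite jm => im; have [_ _ _ /(_ i)] := sQ m lm.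
      by rewrite size_take lm /pt /fn nth_take // => /(_ im).
    have [_ _ /(_ i j ij) + _] := sQ m lm.
    rewrite size_take lm /pt /fn !nth_take ?(ltn_trans ij) // => /(_ jm).
    by [].
  have wU : weak_cvg U (fun T => w (T x)) (w x).
    exact: (weak_cvg_comp hS (isom_contraction wI) Ux).
  have dfn j : (j < size s)%N -> dual_space X (fn s j).
    by move=> /(sQ j) [_ [? _] _ _].
  have near_s : \forall T \near U, forall ij : 'I_(size s) * 'I_(size s),
      (ij.1 < ij.2)%N ->
      re (fn s ij.2 (pt s ij.1)) + e / 4 < re (fn s ij.2 (w (T x))).
    apply: filter_forall => -[i j] /=.
    have [ij|ij] := ltnP i j; last by apply: filterE.
    have := weak_cvg_re hS (@filter_filter _ _ UP) (dfn j (ltn_ord j)) wU.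
    move/cvgr_gt => /(_ _ (sw i j ij (ltn_ord j))).
    by apply: filterS => T + _.
  have wn (T : X -> X) : nr (w (T x) - w x) = nr (T x - x).
    by case: wI => wl wn _; rewrite -linB // wn.
  have weU : \forall T \near U, e <= nr (w (T x) - w x).
    by apply: filterS eU => T; rewrite wn.
  have near_h := weak_escape (fun i : 'I_(size s) => pt s i) UU e0 wU weU.
  have [T [[TI Ts] Th]] := filter_ex (filterI (filterI UI near_s) near_h).
  have [phi [uphi phie]] := separate_from_hull Th.
  exists (w \o T, phi); split=> //=; first exact: isom_comp.
    move=> i j ij js; have il := ltn_trans ij js.
    exact: (Ts (Ordinal il, Ordinal js)).
  by move=> i il; have := phie (Ordinal il); rewrite /=; lra.
pose xs n := (f n).1 x; pose ph n := (f n).2.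
have sep i j k : (i < j <= k)%N -> re (ph j (xs i)) + e / 4 < re (ph j (xs k)).
  case/andP=> ij; have [_ _ fQ3 fQ4] := fQ k.
  rewrite leq_eqVlt => /orP[/eqP jk|jk].
    move: ij; rewrite jk => ik.
    by have := fQ4 i; rewrite size_mkseq /pt nth_mkseq // => /(_ ik).
  have := fQ3 i j ij; rewrite size_mkseq /pt /fn.
  by rewrite !nth_mkseq ?(ltn_trans ij jk) // => /(_ jk).
have [V [VU NV]] := ultraFilterLemma (@eventually_filter).
have VP : ProperFilter V by exact: ultra_proper.
have [z xz] : exists z, weak_cvg V xs z.
  apply: (ultra_weak_cvg (M := nr x) hS hrefl VU); apply: filterE => n.
  by have [fI _ _ _] := fQ n; exact: (contraction_nr hS _ (isom_contraction fI)).
have [psi [upsi phpsi]] := ultra_dual_cvg (phi := ph) hS VU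
  (fun n => let: And4 _ u _ _ := fQ n in u).
have sepz i j : (i < j)%N -> re (ph j (xs i)) + e / 4 <= re (ph j z).
  move=> ij; have [_ [dj _] _ _] := fQ j.
  apply: (cvgr_to_ge (weak_cvg_re hS (@filter_filter _ _ VP) dj xz)).
  apply: NV; near=> k; apply/ltW/sep; rewrite ij /=.
  by near: k; exact: nbhs_infty_ge.
have psiz i : re (psi (xs i)) + e / 4 <= re (psi z).
  rewrite addrC -lerBrDr.
  apply: (@cvgr_to_ge _ V _ _ (fun j => re (ph j z) - re (ph j (xs i)))).
    by apply: cvgB; apply: (cvg_re hS); exact: phpsi.
  apply: NV; near=> j; rewrite lerBrDr addrC; apply: sepz.
  by near: j; exact: nbhs_infty_gt.
have : e / 4 <= re (psi z) - re (psi z).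
  apply: (@cvgr_to_ge _ V _ _ (fun i => re (psi z) - re (psi (xs i)))).
    apply: cvgB; first exact: cvg_cst.
    exact: (weak_cvg_re hS _ upsi.1 xz).
  by apply: filterE => i; have := psiz i; lra.
lra.
Unshelve. all: by end_near. Qed.

End IsometricOrbits.

(** * Korovkin envelopes as fixed spaces *)

Section Envelopes.
Context {R : realType} {K : numFieldType} {re : K -> R}
  {emb : {rmorphism R -> K}} (hS : real_part re emb) {X : normedModType K}.
Local Notation nr x := (re `|x|).
Implicit Types (S C : set (X -> X)) (A : set X) (T : X -> X) (x : X).

Definition cvg_to_id_on (F : set_system (X -> X)) A : Prop :=
  forall a, A a -> (fun T : X -> X => T a) @ F --> a.

Lemma tails_proper (I : Type) (le : I -> I -> Prop) :
  directed_preorder le -> ProperFilter (tails le).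
Proof.
move=> [[i0] le_refl le_trans' le_dir]; split.
  by move=> [i /(_ i (le_refl i))].
split.
- by exists i0.
- move=> P Q [i iP] [j jQ]; have [k [ik jk]] := le_dir i j.
  exists k => l kl; split; first exact: iP (le_trans' _ _ _ ik kl).
  exact: jQ (le_trans' _ _ _ jk kl).
- by move=> P Q PQ [i iP]; exists i => j ij; exact: PQ (iP j ij).
Qed.

(** Nets may be replaced by filters on the set of operators.  A filter is turned
    into a net indexed by its members with a chosen point in each, ordered by
    reverse inclusion of the members. *)
Lemma envelope_filterP S A x : korovkin_envelope S A x <->
  forall F : set_system (X -> X), ProperFilter F -> F S -> cvg_to_id_on F A ->
    (fun T : X -> X => T x) @ F --> x.
Proof.
split=> [xE F FF FS FA|xE I le T dle ST TA]; last first.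
  have tailsP := tails_proper dle.
  apply: (xE (T @ tails le)) => //.
  by have [[i0] _ _ _] := dle; exists i0 => j _; exact: ST.
pose I := {p : set (X -> X) * (X -> X) | [/\ F p.1, S p.2 & p.1 p.2]}.
pose le (p q : I) := (sval q).1 `<=` (sval p).1.
have FF' : Filter F := @filter_filter _ _ FF.
have mkI B : F B -> exists p : I, (sval p).1 = B `&` S.
  move=> FB; have FBS : F (B `&` S) by exact: filterI.
  have [T [BT TS]] := filter_ex FBS.
  by exists (exist _ (B `&` S, T) (And3 FBS TS (conj BT TS))).
have cvgI : (fun p : I => (sval p).2 x) @ tails le --> x.
  apply: (xE I le (fun p => (sval p).2)).
  - split.
    + by have [p _] := mkI _ filterT; exact: inhabits p.
    + by move=> p.
    + by move=> p q r pq qr T /qr /pq.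
    + move=> p q; have [r rE] : exists r : I, (sval r).1 =
          ((sval p).1 `&` (sval q).1) `&` S.
        by apply: mkI; apply: filterI; [have [] := svalP p|have [] := svalP q].
      by exists r; split=> T; rewrite rE => -[[]].
  - by move=> p; have [] := svalP p.
  - move=> a Aa N /(FA a Aa) /mkI[p pE]; exists p => q pq.
    have [_ _ qq] := svalP q; have := pq _ qq.
    by rewrite pE => -[].
move=> N /cvgI[[[B T0] /= [FB ST0 BT0]] pN].
have FBS : F (B `&` S) by exact: filterI.
have BSN T : (B `&` S) T -> N (T x).
  move=> [BT ST].
  exact: (pN (exist _ (B, T) (And3 FB ST BT))).
exact: filterS BSN FBS.
Qed.

Lemma mem_envelope_ultra S A x :
  (forall U : set_system (X -> X), UltraFilter U -> U S -> cvg_to_id_on U A ->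
     (fun T : X -> X => T x) @ U --> x) ->
  korovkin_envelope S A x.
Proof.
move=> xU; apply/envelope_filterP => F FF FS FA N Nx.
apply: contrapT => FN; pose B := [set T : X -> X | N (T x)].
have FF' : Filter F := @filter_filter _ _ FF.
have GP : ProperFilter (within (~` B) F).
  split; last exact: within_filter.
  move=> h; apply: FN; have hB T : ((~` B) T -> False) -> N (T x).
    by move=> /contrapT.
  exact: filterS hB h.
have [U [UU GU]] := ultraFilterLemma GP.
have FU P : F P -> U P by move=> FP; apply: GU; rewrite /within /=; apply: filterS FP.
have /(_ N Nx) UB := xU U UU (FU _ FS) (fun a Aa P aP => FU _ (FA a Aa P aP)).
have UcB : U (~` B) by apply: GU; exact: withinT.
have [T [BT nBT]] := filter_ex (filterI (UB : U B) UcB); exact: nBT BT.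
Qed.

Definition wot_limits S A : set (X -> X) := [set T | exists U : set_system (X -> X),
  [/\ UltraFilter U, U S, cvg_to_id_on U A & wot_cvg U id T]].

Lemma envelope_sub_fixed S A : korovkin_envelope S A `<=` fixed_space (wot_limits S A).
Proof.
move=> x /envelope_filterP xE T [U [UU US UA UT]].
have UP : ProperFilter U by exact: ultra_proper.
apply: (weak_cvg_unique hS UP (UT x)).
by apply: cvg_weak; exact: xE.
Qed.

Lemma wot_limits_fix S A T a : wot_limits S A T -> A a -> T a = a.
Proof.
move=> [U [UU US UA UT]] Aa; have UP : ProperFilter U by exact: ultra_proper.
apply: (weak_cvg_unique hS UP (UT a)); apply: cvg_weak; exact: UA.
Qed.

Lemma wot_limits_contraction S A : S `<=` contractions X ->
  wot_limits S A `<=` contractions X.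
Proof.
move=> Sc T [U [UU US UA UT]].
by apply: (wot_cvg_contraction hS (@ultra_proper _ _ UU) _ UT); exact: filterS US.
Qed.

(** If [x] is fixed by the limits, isometries tending to the identity on [A]
    move [x] weakly to [x], hence in norm since [x] runs through an orbit. *)
Lemma isometric_envelope_fixed A : reflexive_space X ->
  isometric_envelope A = fixed_space (wot_limits (Isom X) A).
Proof.
move=> hrefl; apply/seteqP; split; first exact: envelope_sub_fixed.
move=> x xfix; apply: mem_envelope_ultra => U UU UI UA.
have [T [_ UT]] := ultra_wot_cvg (S := id) hS hrefl UU
  (filterS (@isom_contraction _ X) UI).
have Tx : T x = x by apply: xfix; exists U.
apply: (isom_orbit_cvg hS hrefl UU UI).
by have := UT x; rewrite Tx.
Qed.

Definition contractions_fixing A : set (X -> X) :=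
  [set T | contractions X T /\ forall a, A a -> T a = a].

Lemma contractions_fixing_semigroup A : convex_semigroup emb (contractions_fixing A).
Proof.
split.
- by move=> T [].
- by split=> //; split.
- move=> S T [[Sl Sn] Sf] [[Tl Tn] Tf]; split.
    split=> [|x /=]; first exact: linear_comp.
    exact: le_trans (Sn _) (Tn _).
  by move=> a Aa /=; rewrite Tf // Sf.
- move=> S T s t [cS Sf] [cT Tf] s0 t0 st; split.
    apply: (nr_contraction hS) => [a x y|x].
      rewrite cS.1 cT.1 !scalerDr addrACA !scalerA.
      by rewrite (mulrC (emb s)) (mulrC (emb t)).
    apply: le_trans (nrD hS _ _) _; rewrite !(nrZp hS) //.
    rewrite -[leRHS]mul1r -st mulrDl.
    by rewrite lerD // ler_wpM2l // (contraction_nr hS).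
  by move=> a Aa; rewrite Sf // Tf // -scalerDl -rmorphD st rmorph1 scale1r.
- move=> I U S T UU US UT; have UP : ProperFilter U by exact: ultra_proper.
  split.
    apply: (wot_cvg_contraction hS UP _ UT).
    by apply: filterS US => i [].
  move=> a Aa; apply: (weak_cvg_unique hS UP (UT a)).
  move=> phi dphi; apply: (@cvg_trans _ ((fun=> phi a) @ U)); last exact: cvg_cst.
  by apply: near_eq_cvg; apply: filterS US => i [_ /(_ _ Aa) ->].
Qed.

(** The limits in question are contractions fixing the envelope, so the
    envelope is the fixed space of all contractions that fix it. *)
Lemma isometric_envelope_one_complemented A : reflexive_space X ->
  strictly_convex X -> one_complemented (isometric_envelope A).
Proof.
move=> hrefl hX; rewrite (isometric_envelope_fixed _ hrefl).
set Z := fixed_space _.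
have [p [[cp _] pp pZ]] :=
  fixed_space_projection hS hrefl hX (contractions_fixing_semigroup Z).
exists p; split=> //; rewrite pZ; apply/seteqP; split=> x xZ.
  move=> T LT; apply: xZ; split; last by move=> z; exact.
  exact: wot_limits_contraction (@isom_contraction _ X) _ LT.
by move=> T [_ Tf]; exact: Tf.
Qed.

(** Points of the ball that almost attain the norm of a functional [phi] norming
    [x] are close to [x]: the norm of [(v + x) / 2] is at least its value under
    [phi]. *)
Lemma lur_slice x phi : locally_uniformly_convex X -> unit_dual re phi ->
  re (phi x) = nr x -> forall e, 0 < e -> exists2 d, 0 < d &
    forall v, nr v <= nr x -> nr x - d < re (phi v) -> nr (v - x) < e.
Proof.
move=> lur uphi phix e e0.
have [x0|x0] := eqVneq x 0.
  exists 1 => // v; rewrite x0 (nr0 hS) => /(nr_le0 hS) -> _.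
  by rewrite subr0 (nr0 hS).
have r0 : 0 < nr x by apply: (re_gt0 hS); rewrite normr_gt0.
pose r := nr x; pose c := emb r^-1.
have rI : 0 <= r^-1 by rewrite invr_ge0 ltW.
have cx1 : `|c *: x| = 1.
  by rewrite -(emb_nr hS) (nrZp hS) // [_ * _]mulVf ?rmorph1 // gt_eqF.
have er : 0 < emb (e / r) by rewrite (emb_gt0 hS) divr_gt0.
have [d0 d00 dP] := lur _ cx1 _ er.
have d0E : emb (re d0) = d0 by rewrite (emb_rp hS) // ltW.
have rd0 := re_gt0 hS d00.
exists (r * re d0) => [|v vx phiv]; first by rewrite mulr_gt0.
have := dP (c *: v).
rewrite -scalerBr -scalerDr scalerA -(@emb_half R K emb) /c -rmorphM.
rewrite -(emb_nr hS (emb r^-1 *: v)) -(emb_nr hS (emb _ *: (v + x))).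
rewrite -(emb_nr hS (emb r^-1 *: (v - x))) -d0E -{1 2}(rmorph1 emb) -rmorphB.
have h2 : (0 : R) <= 2^-1 by rewrite invr_ge0.
rewrite (emb_le hS) !(emb_lt hS) !(nrZp hS) ?mulr_ge0 //.
rewrite [r^-1 * nr (v - x)]mulrC ltr_pM2r ?invr_gt0 //; apply.
  by rewrite mulrC ler_pdivrMr // mul1r.
have : nr x + re (phi v) <= nr (v + x).
  apply: le_trans (uphi.2 (v + x)); apply: le_trans (rp_le_norm hS _).
  by rewrite (linD _ _ uphi.1.1) (rpD hS) phix addrC.
rewrite -/r in r0 phiv *; have rd1 := mulr_gt0 r0 rd0 => vxn.
rewrite -mulrA mulrCA ltr_pdivlMl //; lra.
Qed.

(** A contraction fixing [A] gives a constant net, which proves one inclusion.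
    Conversely, limits of contractions tending to the identity on [A] fix [A],
    hence [x]; so [x] is a weak limit of vectors [T x] of norm at most [nr x],
    and local uniform convexity makes the limit strong. *)
Lemma contraction_envelope_fixed A : reflexive_space X ->
  locally_uniformly_convex X ->
  korovkin_envelope (contractions X) A = fixed_space (contractions_fixing A).
Proof.
move=> hrefl lur; apply/seteqP; split=> x.
  move=> /envelope_filterP xE T [cT Tf].
  have FT : ProperFilter (principal_filter T) := principal_filter_proper T.
  have Tcvg y : (fun T : X -> X => T y) @ principal_filter T --> T y.
    by move=> N /nbhs_singleton Ny; apply/principal_filterP.
  apply: (cvg_unique (norm_hausdorff (V := X)) (Tcvg x)); apply: xE.
    exact/principal_filterP.
  by move=> a Aa; rewrite -[X in _ --> X](Tf a Aa).
move=> xfix; apply: mem_envelope_ultra => U UU UC UA.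
have UP : ProperFilter U by exact: ultra_proper.
have [T [cT UT]] := ultra_wot_cvg (S := id) hS hrefl UU UC.
have LT : wot_limits (contractions X) A T by exists U.
have Tx : T x = x by apply: xfix; split=> // a; exact: wot_limits_fix LT.
have [phi [uphi phix]] := norming hS x.
apply/(cvg_nrP hS) => e e0; have [d d0 dP] := lur_slice lur uphi phix e0.
have := weak_cvg_re hS (@filter_filter _ _ UP) uphi.1 (UT x).
rewrite Tx phix => /cvgr_gt /(_ (nr x - d)).
rewrite ltrBlDr ltrDl => /(_ d0); apply: filterS2 UC => S cS.
by apply: dP; exact: (contraction_nr hS).
Qed.

End Envelopes.

(** * The closed convex hull of the isometries *)

Section ConvexHull.
Context {R : realType} {K : numFieldType} {re : K -> R}
  {emb : {rmorphism R -> K}} (hS : real_part re emb) {X : normedModType K}.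
Local Notation nr x := (re `|x|).
Implicit Types (A : set (X -> X)) (S T : X -> X).

(** Arbitrary finite index sets allow disjoint unions and products as indices of
    convex combinations and composites. *)
Lemma convex_hull_fin (J : finType) A (a : J -> K) (S : J -> X -> X) :
  (forall j, 0 <= a j) -> \sum_j a j = 1 -> (forall j, A (S j)) ->
  convex_hull A (fun x => \sum_j a j *: S j x).
Proof.
have sumE (W : nmodType) (F : J -> W) : \sum_j F j = \sum_(i < #|J|) F (enum_val i).
  by rewrite (reindex (@enum_val J predT)) //; exact: onW_bij (enum_val_bij J).
move=> a0 a1 AS; exists #|J|, (a \o enum_val), (S \o enum_val); split => //=.
- by rewrite -a1 sumE.
- by apply/funext => x; rewrite sumE.
Qed.

Lemma sub_convex_hull A : A `<=` convex_hull A.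
Proof.
move=> T AT; exists 1%N, (fun=> 1), (fun=> T); split=> //.
  by rewrite big_ord1.
by apply/funext => x; rewrite big_ord1 scale1r.
Qed.

Lemma convex_hull_convex A S T s t : convex_hull A S -> convex_hull A T ->
  0 <= s -> 0 <= t -> s + t = 1 ->
  convex_hull A (fun x => emb s *: S x + emb t *: T x).
Proof.
move=> [n [a [P [a0 a1 AP ->]]]] [m [b [Q [b0 b1 AQ ->]]]] s0 t0 st.
have := @convex_hull_fin ('I_n + 'I_m)%type A
  (fun k => match k with inl i => emb s * a i | inr j => emb t * b j end)
  (fun k => match k with inl i => P i | inr j => Q j end).
rewrite big_sumType /= -!mulr_sumr a1 b1 !mulr1 -rmorphD st rmorph1.
move=> H; have -> : (fun x => emb s *: \sum_i a i *: P i x +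
    emb t *: \sum_i b i *: Q i x) = (fun x => \sum_(k : 'I_n + 'I_m)
      match k with inl i => emb s * a i | inr j => emb t * b j end *:
      match k with inl i => P i | inr j => Q j end x).
  apply/funext => x; rewrite big_sumType /= !scaler_sumr.
  by congr (_ + _); apply: eq_bigr => i _; rewrite scalerA.
apply: H => // -[i|j] //; by rewrite mulr_ge0 // (emb_ge0 hS).
Qed.

Lemma convex_hull_comp A S T : (forall P, A P -> linear P) ->
  (forall P Q, A P -> A Q -> A (P \o Q)) ->
  convex_hull A S -> convex_hull A T -> convex_hull A (S \o T).
Proof.
move=> Alin Acomp [n [a [P [a0 a1 AP ->]]]] [m [b [Q [b0 b1 AQ ->]]]].
have := @convex_hull_fin ('I_n * 'I_m)%type A (fun k => a k.1 * b k.2)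
  (fun k => P k.1 \o Q k.2).
move=> H.
have -> : (fun x => \sum_i a i *: P i x) \o (fun x => \sum_i b i *: Q i x) =
    (fun x => \sum_(k : 'I_n * 'I_m) (a k.1 * b k.2) *: (P k.1 \o Q k.2) x).
  apply/funext => x /=.
  rewrite -(pair_bigA _ (fun i j => (a i * b j) *: P i (Q j x))) /=.
  apply: eq_bigr => i _.
  rewrite (lin_sum _ _ _ (Alin _ (AP i))) scaler_sumr; apply: eq_bigr => j _.
  by rewrite (linZ _ _ (Alin _ (AP i))) scalerA.
apply: H => [[i j]||[i j]] /=.
- by rewrite mulr_ge0.
- rewrite -(pair_bigA _ (fun i j => a i * b j)) /= -a1.
  by apply: eq_bigr => i _; rewrite -mulr_sumr b1 mulr1.
- exact: Acomp.
Qed.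

Lemma hull_weight n (a : 'I_n -> K) : (forall i, 0 <= a i) -> \sum_i a i = 1 ->
  (forall i, 0 <= re (a i)) /\ \sum_i re (a i) = 1.
Proof.
move=> a0 a1; split=> [i|].
  by rewrite -(emb_ge0 hS) (emb_rp hS).
by rewrite -(re_sum hS) a1 -(rmorph1 emb) (rp_emb hS).
Qed.

Lemma nr_convex_comb n (a : 'I_n -> K) (v : 'I_n -> X) : (forall i, 0 <= a i) ->
  nr (\sum_i a i *: v i) <= \sum_i re (a i) * nr (v i).
Proof.
move=> a0.
elim/big_ind2: _ => [|x c y d xc yd|i _].
- by rewrite (nr0 hS).
- by apply: le_trans (nrD hS _ _) _; exact: lerD.
- by rewrite (nrZ hS) ger0_norm.
Qed.

Lemma convex_hull_contraction A : A `<=` contractions X ->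
  convex_hull A `<=` contractions X.
Proof.
move=> Ac _ [n [a [S [a0 a1 AS ->]]]]; have [w0 w1] := hull_weight a0 a1.
apply: (nr_contraction hS) => [b x y|x].
  rewrite scaler_sumr -big_split; apply: eq_bigr => i _ /=.
  by rewrite (Ac _ (AS i)).1 scalerDr !scalerA mulrC.
apply: le_trans (nr_convex_comb _ a0) _.
rewrite -[leRHS]mul1r -w1 mulr_suml; apply: ler_sum => i _.
by rewrite ler_wpM2l // (contraction_nr hS) //; exact: Ac.
Qed.

(** Basic neighbourhoods of [T] are indexed by finite families of vectors and
    functionals; concatenating two families intersects the neighbourhoods. *)
Lemma wot_closure_ultra A T : wot_closure A T -> exists U : set_system (X -> X),
  [/\ UltraFilter U, U A & wot_cvg U id T].
Proof.
move=> [Tl Tc TA].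
pose I := {n & (('I_n -> X) * ('I_n -> X -> K^o))%type}.
pose D : set (I * R) :=
  [set p | (forall k, dual_space X ((projT2 p.1).2 k)) /\ 0 < p.2].
pose B (p : I * R) : set (X -> X) := [set S | A S /\ forall k,
  nr ((projT2 p.1).2 k (S ((projT2 p.1).1 k)) -
      (projT2 p.1).2 k (T ((projT2 p.1).1 k))) < p.2].
have BF : ProperFilter (filter_from D B).
  apply: filter_from_proper; last first.
    move=> [[n [x phi]] e] /= [dphi e0].
    have e0' : 0 < emb e by rewrite (emb_gt0 hS).
    have [S AS Se] := TA n x phi _ dphi e0'.
    exists S; split=> // k.
    by rewrite -(emb_lt hS) (emb_nr hS (_ : K^o)); exact: Se.
  apply: filter_from_filter.
    exists (existT _ 0%N (fun=> 0, fun=> 0), 1); split=> //=.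
    by move=> k; exact: dual0.
  move=> [[n [x phi]] e] [[m [y psi]] d] [/= dphi e0] [/= dpsi d0].
  exists (existT _ (n + m)%N
    (fun k : 'I_(n + m) => match fintype.split k with inl i => x i | inr j => y j end,
     fun k : 'I_(n + m) => match fintype.split k with
                           inl i => phi i | inr j => psi j end), Num.min e d).
    split=> /=; last by rewrite lt_min e0.
    by move=> k; case: (fintype.split k) => ?; [exact: dphi|exact: dpsi].
  move=> S [/= AS Sk]; split; split=> //= k.
    have := Sk (unsplit (inl k)); rewrite unsplitK lt_min.
    by case/andP.
  have := Sk (unsplit (inr k)); rewrite unsplitK lt_min.
  by case/andP.
have [U [UU BU]] := ultraFilterLemma BF.
have UB p : D p -> U (B p) by move=> Dp; apply: BU; exists p.
exists U; split=> //.
  have /UB : D (existT _ 0%N (fun=> 0, fun=> 0), 1).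
    by split=> //= k; exact: dual0.
  by apply: filterS => S [].
move=> x phi dphi; apply/(cvg_nrP hS (V := K^o)) => e e0.
have /UB : D (existT _ 1%N (fun=> x, fun=> phi), e) by split.
by apply: filterS => S [_ /(_ ord0)].
Qed.

Lemma wot_closure_contraction A : A `<=` contractions X ->
  wot_closure A `<=` contractions X.
Proof.
move=> Ac T /wot_closure_ultra[U [UU UA UT]].
apply: (wot_cvg_contraction hS (@ultra_proper _ _ UU) _ UT).
exact: filterS UA.
Qed.

Lemma contraction_continuous T : contractions X T -> continuous T.
Proof.
move=> cT; apply: (@lipschitz_continuous _ _ _ _ hS _ _ _ 1); first exact: cT.1.
by move=> x; rewrite mul1r (contraction_nr hS).
Qed.

Lemma wot_closureP A T : wot_closure A T <-> [/\ linear T, continuous T &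
  forall n (x : 'I_n -> X) (phi : 'I_n -> X -> K^o) (e : R),
    (forall k, dual_space X (phi k)) -> 0 < e ->
    exists2 S, A S & forall k, nr (phi k (S (x k)) - phi k (T (x k))) < e].
Proof.
split=> -[Tl Tc TA]; split=> // n x phi e dphi e0.
  have e0' : 0 < emb e by rewrite (emb_gt0 hS).
  have [S AS Sx] := TA n x phi _ dphi e0'; exists S => // k.
  by rewrite -(emb_lt hS) (emb_nr hS (_ : K^o)); exact: Sx.
have [S AS Sx] := TA n x phi _ dphi (re_gt0 hS e0); exists S => // k.
have := Sx k; rewrite -(emb_lt hS) (emb_nr hS (_ - _ : K^o)).
by rewrite (emb_rp hS) // ltW.
Qed.

Lemma wot_convex_isom_contraction : wot_convex_isom X `<=` contractions X.
Proof.
apply: wot_closure_contraction; apply: convex_hull_contraction.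
exact: isom_contraction.
Qed.

Lemma wot_convex_isom_id : wot_convex_isom X id.
Proof.
apply/wot_closureP; split=> // [x|n x phi e dphi e0]; first exact: cvg_id.
exists id; first by apply: sub_convex_hull; exact: isom_id.
by move=> k; rewrite subrr normr0 (re0 hS).
Qed.

(** Composition is only separately continuous: first [S] is approximated by
    [S'] at the vectors [T x_k], then [T] by [T'] for the functionals
    [phi_k \o S']. *)
Lemma wot_convex_isom_comp S T : wot_convex_isom X S -> wot_convex_isom X T ->
  wot_convex_isom X (S \o T).
Proof.
move=> wS wT; have cS := wot_convex_isom_contraction wS.
have cT := wot_convex_isom_contraction wT.
have cST : contractions X (S \o T).
  split; first exact: linear_comp cS.1 cT.1.
  by move=> x; apply: le_trans (cS.2 _) (cT.2 _).
apply/wot_closureP; split; [exact: cST.1|exact: contraction_continuous|].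
move=> n x phi e dphi e0; have e2 : 0 < e / 2 by rewrite divr_gt0.
have /wot_closureP[_ _ /(_ n (T \o x) phi _ dphi e2)[S' hS' S'x]] := wS.
have cS' : contractions X S'.
  exact: (convex_hull_contraction (@isom_contraction _ X) hS').
have dphi' k : dual_space X (phi k \o S' : X -> K^o) by exact: (dual_comp hS).
have /wot_closureP[_ _ /(_ n x _ _ dphi' e2)[T' hT' T'x]] := wT.
exists (S' \o T') => [|k].
  apply: convex_hull_comp => //; first by move=> P [].
  exact: isom_comp.
have := S'x k; have := T'x k => /=.
have := nr_tri hS (phi k (S' (T (x k))) : K^o)
  (phi k (S' (T' (x k)))) (phi k (S (T (x k)))).
lra.
Qed.

Lemma wot_convex_isom_convex S T s t : wot_convex_isom X S -> wot_convex_isom X T ->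
  0 <= s -> 0 <= t -> s + t = 1 ->
  wot_convex_isom X (fun x : X => emb s *: S x + emb t *: T x).
Proof.
move=> wS wT s0 t0 st; have cS := wot_convex_isom_contraction wS.
have cT := wot_convex_isom_contraction wT.
have cST : contractions X (fun x : X => emb s *: S x + emb t *: T x).
  have h := contractions_fixing_semigroup hS (set0 : set X).
  by have [] := csg_convex h (conj cS (fun x (f : set0 x) => False_ind _ f))
    (conj cT (fun x (f : set0 x) => False_ind _ f)) s0 t0 st.
apply/wot_closureP; split; [exact: cST.1|exact: contraction_continuous|].
move=> n x phi e dphi e0; have e2 : 0 < e / 2 by rewrite divr_gt0.
have /wot_closureP[_ _ /(_ n x phi _ dphi e2)[S' hS' S'x]] := wS.
have /wot_closureP[_ _ /(_ n x phi _ dphi e2)[T' hT' T'x]] := wT.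
exists (fun x => emb s *: S' x + emb t *: T' x); first exact: convex_hull_convex.
move=> k; have lphi := (dphi k).1.
rewrite !(linD _ _ lphi) !(linZ _ _ lphi) opprD addrACA -!scalerBr.
apply: le_lt_trans (nrD hS _ _) _.
rewrite !(nrZp hS (V := K^o)) //.
have := S'x k; have := T'x k.
have s1 : s <= 1 by lra.
have t1 : t <= 1 by lra.
have := nr_ge0 hS (phi k (S' (x k)) - phi k (S (x k)) : K^o).
have := nr_ge0 hS (phi k (T' (x k)) - phi k (T (x k)) : K^o).
by nra.
Qed.

Lemma wot_convex_isom_closed (I : Type) (U : set_system I) (S : I -> X -> X) T :
  UltraFilter U -> (\forall i \near U, wot_convex_isom X (S i)) -> wot_cvg U S T ->
  wot_convex_isom X T.
Proof.
move=> UU US UT; have UP : ProperFilter U by exact: ultra_proper.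
have cT : contractions X T.
  apply: (wot_cvg_contraction hS UP _ UT).
  by apply: filterS US => i; exact: wot_convex_isom_contraction.
apply/wot_closureP; split; [exact: cT.1|exact: contraction_continuous|].
move=> n x phi e dphi e0; have e2 : 0 < e / 2 by rewrite divr_gt0.
have near_T : \forall i \near U, forall k,
    nr (phi k (S i (x k)) - phi k (T (x k)) : K^o) < e / 2.
  apply: filter_forall => k.
  by have /(cvg_nrP hS) /(_ _ e2) := UT (x k) _ (dphi k).
have [j [wj jT]] := filter_ex (filterI US near_T).
have /wot_closureP[_ _ /(_ n x phi _ dphi e2)[S' hS' S'x]] := wj.
exists S' => // k; have := S'x k; have := jT k.
have := nr_tri hS (phi k (S j (x k)) : K^o) (phi k (S' (x k))) (phi k (T (x k))).
lra.
Qed.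

Definition wot_convex_isom_fixing (Y : set X) : set (X -> X) :=
  [set T | wot_convex_isom X T /\ forall y, Y y -> T y = y].

Lemma wot_convex_isom_fixing_semigroup Y :
  convex_semigroup emb (wot_convex_isom_fixing Y).
Proof.
have fixS := contractions_fixing_semigroup hS Y.
have sub T : wot_convex_isom_fixing Y T -> contractions_fixing Y T.
  by move=> [wT Tf]; split=> //; exact: wot_convex_isom_contraction.
split.
- by move=> T [/wot_convex_isom_contraction].
- by split=> //; exact: wot_convex_isom_id.
- move=> S T wS wT; split; first exact: wot_convex_isom_comp wS.1 wT.1.
  by have [] := csg_comp fixS (sub _ wS) (sub _ wT).
- move=> S T s t wS wT s0 t0 st; split.
    exact: wot_convex_isom_convex wS.1 wT.1 s0 t0 st.
  by have [] := csg_convex fixS (sub _ wS) (sub _ wT) s0 t0 st.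
- move=> I U S T UU US UT; split.
    apply: (wot_convex_isom_closed UU _ UT).
    by apply: filterS US => i [].
  have [] := csg_closed fixS UU _ UT => //.
  by apply: filterS US => i; exact: sub.
Qed.

End ConvexHull.

(** * Projections onto the envelopes *)

Section EnvelopeProjections.
Context {R : realType} {K : numFieldType} {re : K -> R}
  {emb : {rmorphism R -> K}} (hS : real_part re emb) {X : normedModType K}.
Local Notation nr x := (re `|x|).
Implicit Types (S T : X -> X).

(** How far [T] is from fixing the points [ys], measured by functionals norming
    them so as to be affine in [T] and continuous in the weak operator
    topology. *)
Definition deviation (phi : X -> X -> K^o) (ys : seq X) T : R :=
  \sum_(y <- ys) (nr y - re (phi y (T y))).

Lemma deviation_term_ge0 (phi : X -> X -> K^o) T y :
  (forall y, unit_dual re (phi y)) -> contractions X T ->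
  0 <= nr y - re (phi y (T y)).
Proof.
move=> uphi cT; rewrite subr_ge0; apply: le_trans (rp_le_norm hS _) _.
by apply: le_trans ((uphi y).2 _) _; exact: (contraction_nr hS).
Qed.

(** If no finite set of points of [Y] and no bound on the deviation forced
    [nr (T x - x) < e], the operators of small deviation with
    [e <= nr (T x - x)] would generate a filter; by local uniform convexity it
    tends to the identity on [Y], so [T x] would tend to [x] along it.  Above
    the threshold [d] on the deviation the trivial bound [2 * nr x] gives the
    inequality, with [c = 2 * nr x / d]. *)
Lemma envelope_deviation (A : set (X -> X)) (Y : set X) (phi : X -> X -> K^o) x e :
  locally_uniformly_convex X -> A `<=` contractions X ->
  (forall y, unit_dual re (phi y) /\ re (phi y y) = nr y) ->
  korovkin_envelope A Y x -> 0 < e ->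
  exists (ys : seq X) (c : R), [/\ forall y, y \in ys -> Y y, 0 <= c &
    forall T, A T -> nr (T x - x) <= e + c * deviation phi ys T].
Proof.
move=> lur Ac phiP /envelope_filterP xE e0.
have uphi y := (phiP y).1.
have dev0 ys T : A T -> 0 <= deviation phi ys T.
  move=> AT; apply: sumr_ge0 => y _.
  exact: (@deviation_term_ge0 phi T y uphi (Ac _ AT)).
suff [ys [d [ysY d0 small]]] : exists (ys : seq X) (d : R),
    [/\ forall y, y \in ys -> Y y, 0 < d &
        forall T, A T -> deviation phi ys T < d -> nr (T x - x) < e].
  exists ys, (2 * nr x / d); split=> //.
    by rewrite divr_ge0 ?mulr_ge0 ?(nr_ge0 hS) // ltW.
  move=> T AT; have [devd|devd] := ltP (deviation phi ys T) d.
    apply: le_trans (ltW (small T AT devd)) _; rewrite lerDl mulr_ge0 ?dev0 //.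
    by rewrite divr_ge0 ?mulr_ge0 ?(nr_ge0 hS) // ltW.
  have Tx : nr (T x - x) <= 2 * nr x.
    have := nrB hS (T x) x; have := contraction_nr hS x (Ac _ AT); lra.
  apply: le_trans Tx _; apply: le_trans (_ : 2 * nr x / d * d <= _).
    by rewrite divfK // gt_eqF.
  apply: ler_wpDl; first exact: ltW.
  by apply: ler_wpM2l => //; rewrite divr_ge0 ?mulr_ge0 ?(nr_ge0 hS) // ltW.
apply: contrapT => nosmall.
pose D : set (seq X * R) :=
  [set p : seq X * R | (forall y, y \in p.1 -> Y y) /\ 0 < p.2].
pose B (p : seq X * R) : set (X -> X) :=
  [set T | [/\ A T, deviation phi p.1 T < p.2 & e <= nr (T x - x)]].
have BF : ProperFilter (filter_from D B).
  apply: filter_from_proper; last first.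
    move=> [ys d] [/= ysY d0]; apply: contrapT => noT.
    apply: nosmall; exists ys, d; split=> // T AT devT.
    rewrite ltNge; apply/negP => eT; apply: noT; exists T; split=> //.
  apply: filter_from_filter; first by exists ([::], 1); split=> //=.
  move=> [ys d] [zs c] [/= ysY d0] [/= zsY c0].
  exists (ys ++ zs, Num.min d c).
    split=> /=; last by rewrite lt_min d0.
    by move=> y; rewrite mem_cat => /orP[/ysY|/zsY].
  move=> T [/= AT]; rewrite /deviation big_cat /= lt_min => /andP[dT cT] eT.
  have := dev0 ys T AT; have := dev0 zs T AT; rewrite /deviation => z0 y0.
  by split; split=> //=; rewrite /deviation; lra.
have BD p : D p -> filter_from D B (B p) by move=> Dp; exists p.
have D1 : D ([::], 1) by split.
have FY : cvg_to_id_on (filter_from D B) Y.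
  move=> y Yy; apply/(cvg_nrP hS) => a a0.
  have [d d0 dP] := lur_slice hS lur (uphi y) (phiP y).2 a0.
  have Dy : D ([:: y], d) by split=> // z; rewrite inE => /eqP ->.
  apply: filterS (BD _ Dy) => T [/= AT].
  rewrite /deviation big_seq1 => devT _; apply: dP; last by lra.
  by apply: (contraction_nr hS); exact: Ac.
have FA : filter_from D B A by apply: filterS (BD _ D1) => T [].
have /(cvg_nrP hS) /(_ e e0) xlim := xE _ BF FA FY.
have [T [Tx [_ _ eT]]] := filter_ex (filterI xlim (BD _ D1)).
by move: Tx; rewrite ltNge eT.
Qed.

Lemma convex_hull_deviation (A : set (X -> X)) (phi : X -> X -> K^o) ys x e c T :
  (forall y, unit_dual re (phi y)) -> convex_hull A T ->
  (forall S, A S -> nr (S x - x) <= e + c * deviation phi ys S) ->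
  nr (T x - x) <= e + c * deviation phi ys T.
Proof.
move=> uphi [n [a [S [a0 a1 AS ->]]]] bound.
have [w0 w1] := hull_weight hS a0 a1.
have -> : \sum_i a i *: S i x - x = \sum_i a i *: (S i x - x).
  under [RHS]eq_bigr => i _ do rewrite scalerBr.
  by rewrite sumrB -scaler_suml a1 scale1r.
apply: le_trans (nr_convex_comb hS _ a0) _.
have -> : deviation phi ys (fun x => \sum_i a i *: S i x) =
    \sum_i re (a i) * deviation phi ys (S i).
  under [RHS]eq_bigr => i _ do rewrite mulr_sumr.
  rewrite exchange_big; apply: eq_bigr => y _ /=.
  under [RHS]eq_bigr => i _ do rewrite mulrBr.
  rewrite sumrB -mulr_suml w1 mul1r; congr (_ - _).
  rewrite (lin_sum _ _ _ (uphi y).1.1) (re_sum hS); apply: eq_bigr => i _.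
  by rewrite (linZ _ _ (uphi y).1.1) -[a i](emb_rp hS) // (rpZ hS) (rp_emb hS).
rewrite mulr_sumr -[e]mul1r -w1 mulr_suml -big_split; apply: ler_sum => i _ /=.
by rewrite mulrCA -mulrDr ler_wpM2l // bound.
Qed.

Lemma wot_closure_deviation (A : set (X -> X)) (phi : X -> X -> K^o) ys x e c T :
  (forall y, unit_dual re (phi y)) -> wot_closure A T ->
  (forall S, A S -> nr (S x - x) <= e + c * deviation phi ys S) -> 0 <= c ->
  nr (T x - x) <= e + c * deviation phi ys T.
Proof.
move=> uphi /(wot_closure_ultra hS)[U [UU UA UT]] bound c0.
have UP : ProperFilter U by exact: ultra_proper.
have devT : (fun S => e + c * deviation phi ys S) @ U --> e + c * deviation phi ys T.
  apply: cvgD; first exact: cvg_cst.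
  apply: cvgM; first exact: cvg_cst.
  apply: (cvg_big (op := +%R)) => [|y _]; first exact: add_continuous.
  apply: cvgB; first exact: cvg_cst.
  exact: (weak_cvg_re hS (@filter_filter _ _ UP) (uphi y).1 (UT y)).
apply/ler_addgt0Pr => d d0.
have Tx : weak_cvg U (fun S => -1 *: x + S x) (T x - x).
  have := weak_cvg_lin (a := -1) (@filter_filter _ _ UP)
    (weak_cvg_cst (x := x) (@filter_filter _ _ UP)) (UT x).
  by rewrite scaleN1r addrC.
apply: (weak_cvg_le hS UP Tx).
have /cvgr_lt /(_ (e + c * deviation phi ys T + d)) := devT.
rewrite ltrDl => /(_ d0); apply: filterS2 UA => S AS /ltW.
by apply: le_trans; rewrite scaleN1r addrC; exact: bound.
Qed.

(** For [T] fixing [Y] the deviation vanishes, so the inequality valid on all the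
    isometries, extended to [T], gives [nr (T x - x) <= e].  Conversely, the weak
    operator limits of isometries that fix [Y] belong to the closed hull. *)
Lemma isometric_envelope_wot (Y : set X) : reflexive_space X ->
  locally_uniformly_convex X ->
  isometric_envelope Y = fixed_space (wot_convex_isom_fixing Y).
Proof.
move=> hrefl lur; apply/seteqP; split=> x; last first.
  rewrite (isometric_envelope_fixed hS _ hrefl) => xfix T LT; apply: xfix; split.
    have [U [UU UI UY UT]] := LT.
    apply: (wot_convex_isom_closed hS (S := id) UU _ UT).
    apply: filterS UI => S IS.
    have cS := isom_contraction IS.
    apply/(wot_closureP hS); split; [exact: cS.1|exact: (contraction_continuous hS cS)|].
    move=> n z phi e _ e0; exists S; first exact: sub_convex_hull.
    by move=> k; rewrite subrr normr0 (re0 hS).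
  by move=> y; exact: (wot_limits_fix hS LT).
move=> xE T [wT Tf]; apply/eqP; rewrite -subr_eq0; apply/eqP.
apply: (nr_le_eps hS) => e e0.
have /choice[phi phiP] := norming hS (X := X).
have [ys [c [ysY c0 bound]]] :=
  envelope_deviation lur (@isom_contraction _ X) phiP xE e0.
have uphi y := (phiP y).1.
have /(_ _ _) := wot_closure_deviation (x := x) (e := e) (c := c) uphi wT.
move=> /(_ ys) /(_ (fun S hS' => convex_hull_deviation uphi hS' bound) c0).
rewrite /deviation big1_seq ?mulr0 ?addr0 // => y /andP[_ /ysY/Tf ->].
by rewrite (phiP y).2 subrr.
Qed.

(** Two functionals norming [z] and their midpoint all have dual norm [1]. *)
Lemma smooth_norming (phi psi : X -> K^o) z : strictly_convex_dual X ->
  unit_dual re phi -> unit_dual re psi -> z <> 0 ->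
  re (phi z) = nr z -> re (psi z) = nr z -> phi = psi.
Proof.
move=> hX uphi upsi z0 phiz psiz.
have nz : 0 < nr z by apply: (re_gt0 hS); rewrite normr_gt0; apply/eqP.
have ge1 (f : X -> K^o) : dual_space X f -> re (f z) = nr z -> 1 <= re (dual_norm f).
  move=> df fz; rewrite -(ler_pM2r nz) mul1r.
  apply: le_trans (le_dual_norm hS _ df); rewrite -[leLHS]fz.
  exact: (rp_le_norm hS).
have norm1 (f : X -> K^o) : unit_dual re f -> re (f z) = nr z -> dual_norm f = 1.
  move=> uf fz; rewrite -(dual_norm_emb hS uf.1) -(rmorph1 emb); congr (emb _).
  by apply/eqP; rewrite eq_le (dual_norm_le1 hS uf) ge1 //; exact: uf.1.
apply: contrapT => neq.
have := hX _ _ uphi.1 upsi.1 (norm1 _ uphi phiz) (norm1 _ upsi psiz) neq.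
have dh : dual_space X (2^-1 *: (phi + psi) : X -> K^o).
  have := dualP hS 2^-1 (dualP hS 1 uphi.1 upsi.1) (dual0 (X := X)).
  by rewrite scale1r addr0.
rewrite -(dual_norm_emb hS dh) -[X in _ < X](rmorph1 emb) (emb_lt hS) ltNge.
move=> /negP; apply.
apply: ge1 => //; change (re (2^-1 * (phi z + psi z)) = nr z).
by rewrite (@re_half _ _ _ _ hS) (rpD hS) phiz psiz; lra.
Qed.

(** Let [w = p x - q x], which lies in the common range.  If it were nonzero, the
    functional [phi] norming [w] would be unchanged by composition with [p] and
    with [q], so that [phi w = phi x - phi x = 0]. *)
Lemma contractive_projection_unique p q : strictly_convex_dual X ->
  contractions X p -> contractions X q -> projection p -> projection q ->
  range p = range q -> p = q.
Proof.
move=> hX cp cq [_ pp] [_ qq] pq.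
have fixp z : range p z -> p z = z by case=> x _ <-; rewrite -[LHS]/((p \o p) x) pp.
have fixq z : range q z -> q z = z by case=> x _ <-; rewrite -[LHS]/((q \o q) x) qq.
apply/funext => x; apply/eqP; rewrite -subr_eq0; apply/eqP; apply: contrapT.
set w := p x - q x => w0.
have pw : p w = w.
  by rewrite /w (linB _ _ cp.1) (fixp (p x)) ?(fixp (q x)) // ?pq; exists x.
have qw : q w = w.
  by rewrite /w (linB _ _ cq.1) (fixq (p x)) ?(fixq (q x)) // -?pq; exists x.
have [phi [uphi phiw]] := norming hS w.
have ucomp T : contractions X T -> unit_dual re (phi \o T : X -> K^o).
  move=> cT; split; first exact: (dual_comp hS uphi.1 cT).
  move=> y; by apply: le_trans (uphi.2 _) _; exact: (contraction_nr hS).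
have phip : phi \o p = phi.
  by apply: (smooth_norming hX (ucomp _ cp) uphi w0); rewrite /= ?pw.
have phiq : phi \o q = phi.
  by apply: (smooth_norming hX (ucomp _ cq) uphi w0); rewrite /= ?qw.
apply: w0; apply: (nr_eq0 hS); rewrite -phiw /w (linB _ _ uphi.1.1).
rewrite -[phi (p x)]/((phi \o p) x) -[phi (q x)]/((phi \o q) x) phip phiq.
by rewrite subrr (re0 hS).
Qed.

Lemma projection_range_fixed p (Z : set X) x : projection p -> range p = Z ->
  Z x -> p x = x.
Proof. by move=> [_ pp] <- [z _ <-]; rewrite -[LHS]/((p \o p) z) pp. Qed.

(** All three statements, over any scalars described by [real_part]. *)
Lemma envelope_projections (Y : set X) : reflexive_space X -> strictly_convex X ->
  one_complemented (isometric_envelope Y) /\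
  (locally_uniformly_convex X ->
    [/\ smallest_containing
          [set Z | exists p, [/\ wot_convex_isom X p, projection p &
                                 range p = Z]]
          Y (isometric_envelope Y),
        strictly_convex_dual X ->
          exists p, unique [set p | [/\ wot_convex_isom X p, projection p &
                                        range p = isometric_envelope Y]] p /\
            is_minimal_projection
              [set q | [/\ wot_convex_isom X q, projection q &
                           forall y, Y y -> q y = y]] p &
        is_minimal_envelope Y (korovkin_envelope (contractions X) Y)]).
Proof.
move=> hrefl hX; split; first exact: (isometric_envelope_one_complemented hS).
move=> lur.
have [p [[wp pY] pproj prange]] :=
  fixed_space_projection hS hrefl hX (wot_convex_isom_fixing_semigroup hS Y).
have EnvE := isometric_envelope_wot Y hrefl lur.
rewrite -EnvE in prange.
have pfix := projection_range_fixed pproj prange.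
split.
- split; first by exists p.
  + by move=> y Yy; rewrite EnvE => T [_ Tf]; exact: Tf.
  + move=> W [q [wq qproj qW]] YW; rewrite EnvE => x xfix.
    rewrite -qW; exists x => //; apply: xfix; split=> // y Yy.
    by apply: (projection_range_fixed qproj qW); exact: YW.
- move=> hXd; exists p; split.
    split=> // q [wq qproj qrange].
    apply: contractive_projection_unique => //.
    + exact: (wot_convex_isom_contraction hS).
    + exact: (wot_convex_isom_contraction hS).
    + by rewrite prange qrange.
  split=> // q [wq qproj qY].
  have qfix x : isometric_envelope Y x -> q x = x.
    by rewrite EnvE => xfix; exact: xfix.
  have rp x : isometric_envelope Y (p x) by rewrite -prange; exists x.
  have qp : q \o p = p by apply/funext => x /=; rewrite qfix.
  split=> //.
  have pqproj : projection (p \o q).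
    split; first exact: linear_comp pproj.1 qproj.1.
    by apply/funext => x /=; rewrite (qfix (p (q x))) // pfix.
  apply: contractive_projection_unique => //.
  + apply: (wot_convex_isom_contraction hS).
    exact: (wot_convex_isom_comp hS).
  + exact: (wot_convex_isom_contraction hS).
  + apply/seteqP; split=> [_ [x _ <-]|z]; first by exists (q x).
    by rewrite prange => zE; exists z => //=; rewrite qfix // pfix.
- have [r [[cr rY] rproj rrange]] :=
    fixed_space_projection hS hrefl hX (contractions_fixing_semigroup hS Y).
  rewrite (contraction_envelope_fixed hS _ hrefl lur); split; first by exists r.
  + by move=> y Yy T [_ Tf]; exact: Tf.
  + move=> W [q [cq qproj qW]] YW x xfix.
    rewrite -qW; exists x => //; apply: xfix; split=> // y Yy.
    by apply: (projection_range_fixed qproj qW); exact: YW.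
Qed.

End EnvelopeProjections.
Theorem proposition2p24 (R : realType) (K : numFieldType)
    (hK : real_or_complex R K) (X : completeNormedModType K) (Y : set X)
    (hrefl : reflexive_space X) (hX : strictly_convex X)
    (hY : subspace_of Y) (hYc : closed Y) :
  one_complemented (isometric_envelope Y) /\
  (locally_uniformly_convex X ->
    [/\ smallest_containing
          [set Z | exists p, [/\ wot_convex_isom X p, projection p &
                                 range p = Z]]
          Y (isometric_envelope Y),
        strictly_convex_dual X ->
          exists p, unique [set p | [/\ wot_convex_isom X p, projection p &
                                        range p = isometric_envelope Y]] p /\
            is_minimal_projection
              [set q | [/\ wot_convex_isom X q, projection q &
                           forall y, Y y -> q y = y]] p &
        is_minimal_envelope Y (korovkin_envelope (contractions X) Y)]).
Proof.
case: hK X hrefl hX {hY hYc} Y => {K} X hrefl hX Y.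
- exact: (envelope_projections (real_part_real R)).
- exact: (envelope_projections (real_part_complex R)).
Qed.
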